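(* For every integer $k\ge1$, let $R_k(q)$ be the $k$-th rank moment generating function and $\mathcal{R}_k(q)=(q)_\infty R_k(q)$. Then for every integer $k\ge1$, $$\mathcal{R}_{2k}(q)=\mathrm{Tr}_k\left(\phi_M;\,f_2+\frac{B_2}{4},\,f_4+\frac{B_4}{8},\,\ldots,\,f_{2k}+\frac{B_{2k}}{4k}\right)$$ and $$f_{2k}=-\frac{B_{2k}}{4k}+\mathrm{Tr}_k\left(\phi_S;\,\mathcal{R}_2(q),\mathcal{R}_4(q),\ldots,\mathcal{R}_{2k}(q)\right).$$
   Context: Here $q=e^{2\pi i\tau}$ with $\mathrm{Im}(\tau)>0$, $\zeta=e^{2\pi iz}$, $(a)_n=\prod_{j=1}^n(1-aq^{j-1})$ for $n\in\mathbb{N}_0\cup\{\infty\}$. The rank of a partition is its largest part minus its number of parts (the empty partition has rank $0$); $N(m,n)$ is the number of partitions of $n$ with rank $m$, with generating function $$R(\zeta;q)=\sum_{m\in\mathbb{Z},\,n\ge0}N(m,n)\zeta^mq^n=\sum_{n\ge0}\frac{q^{n^2}}{(\zeta q)_n(\zeta^{-1}q)_n},$$ and $R_k(q)=\sum_{n\ge0}\sum_{m\in\mathbb{Z}}m^kN(m,n)q^n$. The mock Eisenstein series $f_k(\tau)$, $k\ge1$, are defined by the expansion in powers of $z$ $$R(\zeta;q)=\frac{\sin(\pi z)}{\pi z\,(q)_\infty}\exp\left(2\sum_{k\ge1}f_k(\tau)\frac{(2\pi iz)^k}{k!}\right).$$ $B_n$ is the $n$-th Bernoulli number. A partition $\lambda\vdash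 k$ is written $\lambda=(1^{m_1},\ldots,k^{m_k})$, with $m_j\ge0$ the multiplicity of the part $j$ and $\sum_jjm_j=k$; $\ell(\lambda)=m_1+\cdots+m_k$. For a function $\phi$ on partitions, $\mathrm{Tr}_k(\phi;X_1,\ldots,X_k)=\sum_{\lambda\vdash k}\phi(\lambda)\prod_{j=1}^kX_j^{m_j}$. For $\lambda\vdash k$, $$\phi_M(\lambda)=(2k)!\prod_{j=1}^k\frac{2^{m_j}}{m_j!\,((2j)!)^{m_j}},\qquad \phi_S(\lambda)=\frac{(2k)!}{2}(-1)^{\ell(\lambda)-1}(\ell(\lambda)-1)!\prod_{j=1}^k\frac{1}{m_j!\,((2j)!)^{m_j}}.$$ *)

(* Defs.v *)
From HB Require Import structures.
From mathcomp Require Export all_boot all_order all_algebra.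
From mathcomp Require Export complex.
From mathcomp Require Export all_classical all_reals all_analysis.
Export Order.TTheory GRing.Theory Num.Theory numFieldNormedType.Exports.

Set Implicit Arguments.
Unset Strict Implicit.
Unset Printing Implicit Defensive.

Local Open Scope classical_set_scope.
Local Open Scope complex_scope.
Local Open Scope ring_scope.

(* A partition of n is given by its multiplicities: [m i] is the multiplicity *)
(* of the part [i.+1].                                                        *)
Definition partitions (n : nat) : {set {ffun 'I_n -> 'I_n.+1}} :=
  [set m : {ffun 'I_n -> 'I_n.+1} | (\sum_(i < n) i.+1 * m i)%N == n]%SET.

Definition nparts n (m : {ffun 'I_n -> 'I_n.+1}) : nat := (\sum_(i < n) m i)%N.

Definition largest_part n (m : {ffun 'I_n -> 'I_n.+1}) : nat :=
  (\max_(i < n | 0 < m i) i.+1)%N.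

Definition rank n (m : {ffun 'I_n -> 'I_n.+1}) : int :=
  (largest_part m)%:Z - (nparts m)%:Z.

Definition rank_count (r : int) (n : nat) : nat :=
  #|[set m in partitions n | rank m == r]%SET|.

Definition partition_trace (F : numFieldType) (k : nat)
    (phi : {ffun 'I_k -> 'I_k.+1} -> rat) (X : nat -> F) : F :=
  \sum_(m in partitions k) ratr (phi m) * \prod_(i < k) X i.+1 ^+ m i.

Definition phiM (k : nat) (m : {ffun 'I_k -> 'I_k.+1}) : rat :=
  ((2 * k)`!)%:R *
  \prod_(i < k) (2 ^+ m i / ((m i)`!%:R * ((2 * i.+1)`!)%:R ^+ m i)).

Definition phiS (k : nat) (m : {ffun 'I_k -> 'I_k.+1}) : rat :=
  ((2 * k)`!)%:R / 2 * (-1) ^+ (nparts m).-1 * ((nparts m).-1)`!%:R *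
  \prod_(i < k) ((m i)`!%:R * ((2 * i.+1)`!)%:R ^+ m i)^-1.

(* [:: B_0; ...; B_(n-1)], from                                               *)
(*   \sum_(j <= n) 'C(n.+1, j) * B_j = (n == 0).                              *)
Fixpoint bernoulli_seq (n : nat) : seq rat :=
  if n is n'.+1 then
    let s := bernoulli_seq n' in
    rcons s (((n' == 0)%:R - \sum_(j < n') 'C(n'.+1, j)%:R * s`_j) / n'.+1%:R)
  else [::].

Definition bernoulli (n : nat) : rat := (bernoulli_seq n.+1)`_n.

Lemma size_bernoulli_seq n : size (bernoulli_seq n) = n.
Proof. by elim: n => //= n IH; rewrite size_rcons IH. Qed.

Lemma nth_bernoulli_seq n j : (j < n)%N -> (bernoulli_seq n)`_j = bernoulli j.
Proof.
elim: n => // n IH; rewrite ltnS leq_eqVlt => /predU1P[-> //|jn].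
by rewrite /= nth_rcons size_bernoulli_seq jn IH.
Qed.

Lemma bernoulli_rec n :
  \sum_(j < n.+1) 'C(n.+1, j)%:R * bernoulli j = (n == 0)%:R.
Proof.
rewrite big_ord_recr /= binSn {2}/bernoulli /=.
rewrite nth_rcons size_bernoulli_seq ltnn eqxx mulrC divfK ?pnatr_eq0//.
under [X in _ - X]eq_bigr => j _ do rewrite nth_bernoulli_seq//.
by rewrite addrC subrK.
Qed.

(* The topology of R[i] is the one given by its norm; mathcomp-analysis only  *)
(* provides it on abstract numFieldTypes and on the copy R[i]^o.              *)
#[non_forgetful_inheritance]
HB.instance Definition _ (R : realType) := PseudoPointedMetric.copy R[i] R[i]^o.
#[non_forgetful_inheritance]
HB.instance Definition _ (R : realType) := GRing.ComAlgebra.copy R[i] R[i]^o.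
#[non_forgetful_inheritance]
HB.instance Definition _ (R : realType) := Vector.copy R[i] R[i]^o.
#[non_forgetful_inheritance]
HB.instance Definition _ (R : realType) := NormedModule.copy R[i] R[i]^o.

Section ComplexFunctions.
Variable R : realType.
Implicit Types z q zeta tau : R[i].

Definition cexp z : R[i] :=
  (expR (complex.Re z))%:C * (cos (complex.Im z) +i* sin (complex.Im z)).

Definition csin z : R[i] := (cexp ('i * z) - cexp (- ('i * z))) / (2 * 'i).

Definition pochhammer (a q : R[i]) (n : nat) : R[i] :=
  \prod_(1 <= j < n.+1) (1 - a * q ^+ j.-1).

Definition pochhammer_inf (a q : R[i]) : R[i] := limn (pochhammer a q).

Definition rank_gf zeta q : R[i] :=
  limn (series (fun n : nat =>
    \sum_(m \in [set: int]) (rank_count m n)%:R * zeta ^ m * q ^+ n)).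

Definition rank_moment (k : nat) q : R[i] :=
  limn (series (fun n : nat =>
    \sum_(m \in [set: int]) m%:~R ^+ k * (rank_count m n)%:R * q ^+ n)).

Definition normalized_rank_moment (k : nat) q : R[i] :=
  pochhammer_inf q q * rank_moment k q.

Definition twopii : R[i] := 2 * pi%:C * 'i.

Definition nome tau : R[i] := cexp (twopii * tau).

(* [f] is the family of mock Eisenstein series (f_k), k >= 1; the value of    *)
(* [f 0] is irrelevant. For fixed tau the expansion is an identity of         *)
(* holomorphic functions of z near 0; z = 0 itself is left out because of the *)
(* division by pi * z.                                                        *)
Definition mock_eisenstein (f : nat -> R[i] -> R[i]) : Prop :=
  forall tau, 0 < complex.Im tau ->
  \forall z \near (0 : R[i])^',
    let q := nome tau in
    let s := series (fun k : nat =>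
      f k.+1 tau * (twopii * z) ^+ k.+1 / k.+1`!%:R) in
    cvgn s /\
    rank_gf (cexp (twopii * z)) q =
      csin (pi%:C * z) / (pi%:C * z * pochhammer_inf q q)
        * cexp (2 * limn s).

End ComplexFunctions.

(* Main.v *)
(* Fix tau and put q = e^(2 pi i tau), c = (q)_oo, z = t / (2 pi i) with t > 0.
   Multiplied by t e^(t/2), the definition of the mock Eisenstein series reads
     t e^(t/2) c R(e^t; q) = (e^t - 1) exp (2 sum_k f_k t^k / k!)      (t -> 0+).
   Both sides have asymptotic expansions to every order in t, that of c R(e^t; q)
   being sum_k (c R_k(q)) t^k / k!, so the expansions agree as polynomials modulo
   powers of X.  Logarithmic differentiation of (e^X - 1) / X brings in the
   Bernoulli numbers, and the moment series r satisfies r' = g' r with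
     g = sum_k (2 f_k + B_k / k) X^k / k!,
   that is, r = exp g and g = log r.  Conjugation of partitions negates the rank,
   so r and hence g are even; the two partition traces are the coefficients of
   exp and log of a power series, by the multinomial theorem. *)
Require Import Defs.
From mathcomp Require Import ring lra zify.

Set Implicit Arguments.
Unset Strict Implicit.
Unset Printing Implicit Defensive.

(** * Conjugation of partitions *)

(** On the ray z = t / (2 pi i) with t > 0, zeta = e^t is real and no identity theorem for
    holomorphic functions is needed: an O(t^(N+1)) comparison of polynomials identifies the
    coefficients. The rank side is expanded without rearranging a double series. A partition of n
    has |rank| at most n, so each e^(t rank) is replaced by its Taylor polynomial and the remainder
    is summed against |q|^n = e^(-h n), h = 2 pi Im tau. This decay has to pay for the number of
    partitions and for e^(t n), hence t < h / 4. Exponential and logarithm are characterised by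
    linear differential equations, which survive truncation. Dividing by X and differentiating cost
    one order each, so order 2k + 1 is needed to reach the coefficient of X^(2k). Nothing says
    beforehand that the odd part of g vanishes: evenness passes from r to g through g = log r. *)

Lemma sum_nat_gt0P (I : finType) (f : I -> nat) :
  reflect (exists i, 0 < f i) (0 < \sum_i f i).
Proof.
apply: (iffP idP) => [|[i fi]]; last by rewrite (bigD1 i) //= ltn_addr.
apply: contraPP => h; apply/negP; rewrite -leqNgt leqn0; apply/eqP.
by apply: big1 => i _; case E: (f i) => [//|l]; case: h; exists i; rewrite E.
Qed.

Section Conjugation.
Variable n : nat.
Implicit Types m : {ffun 'I_n -> 'I_n.+1}.

(* [conj_part m j] is the [j.+1]-st part of the conjugate partition. *)
Definition conj_part m (j : nat) : nat := \sum_(i < n) m i * (j <= i).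

(** Counting over [j < n] misses no part, since [conj_part m j] vanishes from [j = n] on. A count
    over ['I_n] is at most [n], so [inord] never takes its default value. *)
Definition conj_partition m : {ffun 'I_n -> 'I_n.+1} :=
  [ffun p : 'I_n => inord (\sum_(j < n) (conj_part m j == p.+1))].

Lemma conj_partitionE m (p : 'I_n) :
  conj_partition m p = \sum_(j < n) (conj_part m j == p.+1) :> nat.
Proof.
rewrite ffunE inordK // ltnS -[X in _ <= X]card_ord -sum1_card.
by apply: leq_sum => j _; case: eqP.
Qed.

Lemma conj_part_homo m i j : i <= j -> conj_part m j <= conj_part m i.
Proof.
move=> ij; apply: leq_sum => l _; rewrite leq_mul2l.
by case: (leqP j l) => [jl|]; rewrite ?(leq_trans ij jl) ?orbT.
Qed.

Lemma conj_part_nparts m : conj_part m 0 = nparts m.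
Proof. by apply: eq_bigr => i _; rewrite muln1. Qed.

Lemma conj_part_ge m : conj_part m n = 0.
Proof. by apply: big1 => i _; rewrite leqNgt ltn_ord muln0. Qed.

Lemma conj_partS m (i : 'I_n) : conj_part m i = conj_part m i.+1 + m i.
Proof.
rewrite /conj_part (bigD1 i) //= [in RHS](bigD1 i) //= leqnn ltnn muln0 muln1.
rewrite add0n addnC; congr (_ + _); apply: eq_bigr => j ji.
by rewrite ltn_neqAle eq_sym val_eqE ji.
Qed.

Lemma sum_ltn k : k <= n -> \sum_(i < n) (i < k) = k.
Proof. move=> kn; 
transitivity (\sum_(i < n | i < k) 1); first by rewrite [RHS]big_mkcond.
by rewrite -(big_ord_widen n (fun=> 1)) // sum1_card card_ord.
Qed.

(** Passage from multiplicities to parts; [w 0 = 0] discards the [j] at which no part is left. The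
    weights [p], [0 < p] and [i < p] yield the size of the conjugate, its number of parts and its
    own [conj_part] at [i]. *)
Lemma sum_conj_partition m (w : nat -> nat) : nparts m <= n -> w 0 = 0 ->
  \sum_(p < n) w p.+1 * conj_partition m p = \sum_(j < n) w (conj_part m j).
Proof.
move=> mn w0; under eq_bigr do rewrite conj_partitionE big_distrr.
rewrite exchange_big; apply: eq_bigr => j _ /=.
case E: (conj_part m j) => [|l].
  by rewrite w0 big1 // => p _; rewrite muln0.
have ln : l < n.
  by rewrite -E; apply: leq_trans mn; rewrite -conj_part_nparts conj_part_homo.
rewrite (bigD1 (Ordinal ln)) //= eqxx muln1 big1 ?addn0 // => p.
by rewrite -val_eqE eqSS eq_sym /= => /negPf ->; rewrite muln0.
Qed.

Lemma nparts_leq m : m \in partitions n -> nparts m <= n.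
Proof.
rewrite inE => /eqP mk; rewrite -[X in (_ <= X)%N]mk.
by apply: leq_sum => i _; exact: leq_pmull.
Qed.

Lemma conj_partition_in m :
  m \in partitions n -> conj_partition m \in partitions n.
Proof.
move=> mP; rewrite inE (@sum_conj_partition _ id) ?nparts_leq //.
rewrite /conj_part exchange_big /=; apply/eqP.
transitivity (\sum_(i < n) i.+1 * m i); last by move: mP; rewrite inE => /eqP.
apply: eq_bigr => i _; rewrite -big_distrr /= mulnC; congr (_ * _).
by rewrite -[RHS](@sum_ltn i.+1).
Qed.

Lemma largest_part_leq m : largest_part m <= n.
Proof. by apply/bigmax_leqP => i _; exact: ltn_ord. Qed.

Lemma conj_part_gt0 m (j : 'I_n) : (0 < conj_part m j) = (j < largest_part m).
Proof.
apply/sum_nat_gt0P/idP => [[l]|].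
  rewrite muln_gt0 lt0b => /andP[ml jl];
    exact: leq_trans (leq_bigmax_cond _ ml).
move=> jL; apply: contrapT => h; move: jL; apply/negP; rewrite -leqNgt;
  apply/bigmax_leqP => i mi.
rewrite ltnNge; apply/negP => ji; apply: h; exists i.
by rewrite muln_gt0 mi ji.
Qed.

Lemma nparts_conj m : m \in partitions n ->
  nparts (conj_partition m) = largest_part m.
Proof.
move=> mP; have := @sum_conj_partition m (fun p => 0 < p) (nparts_leq mP) erefl.
under eq_bigr do rewrite mul1n.
under [in RHS]eq_bigr do rewrite conj_part_gt0.
by rewrite sum_ltn // largest_part_leq.
Qed.

Lemma largest_part_conj m : m \in partitions n ->
  largest_part (conj_partition m) = nparts m.
Proof.
move=> mP; apply/eqP; rewrite eqn_leq; apply/andP; split.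
  apply/bigmax_leqP => p; rewrite conj_partitionE => /sum_nat_gt0P[j];
    rewrite lt0b => /eqP <-.
  by rewrite -conj_part_nparts conj_part_homo.
case E: (nparts m) => [//|l].
have ln : l < n by rewrite -E nparts_leq.
apply: (@leq_bigmax_cond _ _ (fun i : 'I_n => i.+1) (Ordinal ln)).
rewrite conj_partitionE; apply/sum_nat_gt0P.
exists (Ordinal (leq_ltn_trans (leq0n _) ln)).
by rewrite /= conj_part_nparts E eqxx.
Qed.

Lemma conj_part_conj m p : m \in partitions n ->
  conj_part (conj_partition m) p = \sum_(j < n) (p < conj_part m j).
Proof.
move=> mP.
have := @sum_conj_partition m (fun i => p < i) (nparts_leq mP) erefl.
by under eq_bigr do rewrite mulnC.
Qed.

(** As [conj_part m] is nonincreasing, the [j] with [p < conj_part m j] form an initial segment,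
    whose length is their number. *)
Lemma conj_part_gt m p i : i <= n ->
  (p < conj_part m i) = (i < \sum_(j < n) (p < conj_part m j)).
Proof.
rewrite leq_eqVlt => /predU1P[->|lin].
  rewrite conj_part_ge ltn0; apply/esym/negbTE; rewrite -leqNgt.
  rewrite -[X in _ <= X]card_ord -sum1_card.
  by apply: leq_sum => j _; case: (p < _).
have [pi|pi] := ltnP p (conj_part m i); apply/esym.
  rewrite -[X in X <= _](sum_ltn lin); apply: leq_sum => j _.
  by case: leqP => // ji; rewrite (leq_trans pi) // conj_part_homo // -ltnS.
apply/negbTE; rewrite -leqNgt -[X in _ <= X](sum_ltn (ltnW lin)).
apply: leq_sum => j _; case: (leqP i j) => [ij|_]; last exact: leq_b1.
by rewrite [p < _]ltnNge (leq_trans _ pi) // conj_part_homo.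
Qed.

Lemma conj_partitionK m : m \in partitions n ->
  conj_partition (conj_partition m) = m.
Proof.
move=> mP; apply/ffunP => i; apply/val_inj; rewrite /= conj_partitionE.
have am j : conj_part m j <= n.
  by rewrite (leq_trans (conj_part_homo m (leq0n j))) // conj_part_nparts
    nparts_leq.
(* A multiplicity is a difference of consecutive values of [conj_part]. With [C] the value at [p] of
   [conj_part] for the conjugate, the claim reduces for each [p] to
   [(i.+1 < C) + (C == i.+1) = (i < C)]. *)
apply: (@addnI (conj_part m i.+1)); rewrite -conj_partS.
rewrite -[in LHS](sum_ltn (am i.+1)) -big_split -[RHS](sum_ltn (am i)) /=.
apply: eq_bigr => p _; rewrite conj_part_conj // !conj_part_gt ?ltn_ord //.
  by case: ltngtP.
exact/ltnW/ltn_ord.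
Qed.

Lemma rank_conj m : m \in partitions n -> rank (conj_partition m) = (- rank
  m)%R.
Proof.
by move=> mP; rewrite /rank nparts_conj // largest_part_conj // opprB.
Qed.

Lemma sum_partitions_rankN (V : nmodType) (f : int -> V) :
  (\sum_(m in partitions n) f (rank m) = \sum_(m in partitions n) f (- rank
    m))%R.
Proof.
rewrite (reindex_onto conj_partition conj_partition); last first.
  by move=> m /conj_partitionK.
apply: eq_big => [m|m /andP[]].
  apply/andP/idP => [[h /eqP<-]|mP]; first exact: conj_partition_in.
  by rewrite conj_partition_in ?conj_partitionK.
move=> h /eqP mK; rewrite -rank_conj // -mK; exact: conj_partition_in.
Qed.

End Conjugation.

Local Open Scope ring_scope.

(** * Truncated power series *)

Lemma bernoulli0 : bernoulli 0 = 1.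
Proof. by have := bernoulli_rec 0; rewrite big_ord1 mul1r. Qed.

Lemma bernoulli1 : bernoulli 1 = - 2^-1.
Proof.
have := bernoulli_rec 1; rewrite big_ord_recr big_ord1 /= bernoulli0 mulr1.
rewrite bin0 bin1 => /eqP; rewrite addrC addr_eq0 => /eqP h.
by apply: (@mulfI _ 2%:R) => //; rewrite h mulrN divff.
Qed.

Section TruncatedSeries.
Variable F : numFieldType.
Implicit Types (p r s u a g : {poly F}) (n : nat).

Definition eqX n p r := forall i, (i < n)%N -> p`_i = r`_i.

Lemma eqXW m n p r : (m <= n)%N -> eqX n p r -> eqX m p r.
Proof. by move=> mn h i im; apply/h/(leq_trans im). Qed.

Lemma eqX_trans n p r s : eqX n p r -> eqX n r s -> eqX n p s.
Proof. by move=> h h' i lin; rewrite h // h'. Qed.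

Lemma eqX_sym n p r : eqX n p r -> eqX n r p.
Proof. by move=> h i lin; rewrite h. Qed.

Lemma eqX_refl n p : eqX n p p. Proof. by []. Qed.

Lemma eqXD n p r p' r' :
  eqX n p p' -> eqX n r r' -> eqX n (p + r) (p' + r').
Proof. by move=> h h' i lin; rewrite !coefD h // h'. Qed.

Lemma eqXB n p r p' r' :
  eqX n p p' -> eqX n r r' -> eqX n (p - r) (p' - r').
Proof. by move=> h h' i lin; rewrite !coefB h // h'. Qed.

Lemma eqXM n p r p' r' :
  eqX n p p' -> eqX n r r' -> eqX n (p * r) (p' * r').
Proof.
move=> h h' i lin; rewrite !coefM; apply: eq_bigr => j _.
by rewrite h ?h' //; apply: leq_ltn_trans lin; [exact: leq_subr|rewrite -ltnS].
Qed.

Lemma eqXMl n p r r' : eqX n r r' -> eqX n (p * r) (p * r').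
Proof. exact: eqXM. Qed.

Lemma eqXMr n p r r' : eqX n r r' -> eqX n (r * p) (r' * p).
Proof. by move=> h; apply: eqXM. Qed.

Lemma eqX_deriv n p r : eqX n.+1 p r -> eqX n p^`() r^`().
Proof. by move=> h i lin; rewrite !coef_deriv h. Qed.

Lemma eqX_primitive n p r :
  p`_0 = r`_0 -> eqX n p^`() r^`() -> eqX n.+1 p r.
Proof.
move=> h0 h [//|i] lin; have := h i lin; rewrite !coef_deriv => /eqP.
by rewrite -subr_eq0 -mulrnBl mulrn_eq0 subr_eq0 => /eqP.
Qed.

Lemma eqX_cancelX n p r : eqX n.+1 ('X * p) ('X * r) -> eqX n p r.
Proof. by move=> h i lin; have := h i.+1 lin; rewrite !coefXM. Qed.

Lemma eqX_cancel n u p r : u`_0 != 0 -> eqX n (u * p) (u * r) -> eqX n p r.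
Proof.
move=> u0 h; suff d0 : eqX n (p - r) 0.
  by move=> i lin; have := d0 i lin; rewrite coefB coef0 => /subr0_eq.
have {}h : eqX n (u * (p - r)) 0.
  by move=> i lin; rewrite mulrBr coefB h // subrr coef0.
elim: n h => [//|n IH] h i; rewrite ltnS => lin.
have {}IH := IH (eqXW (leqnSn n) h).
case: (ltngtP i n) lin => // [lin|->] _; first exact: IH.
have := h n (ltnSn n); rewrite coefM big_ord_recl /= subn0 big1 ?addr0.
  by rewrite coef0 => /eqP; rewrite mulf_eq0 (negPf u0) => /eqP.
move=> j _; rewrite IH ?coef0 ?mulr0 //= /bump /=.
by rewrite ltn_subrL /= (leq_ltn_trans _ (ltn_ord j)).
Qed.

(** Each pass through the equation gains one order: the coefficients of [g * a] up to [i] involve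
    only those of [a] up to [i], and they fix the coefficient [i.+1] of [a]. *)
Lemma linear_ode_unique n g a a' : a`_0 = a'`_0 ->
  eqX n a^`() (g * a) -> eqX n a'^`() (g * a') -> eqX n.+1 a a'.
Proof.
move=> h0; elim: n => [|n IH] h h'; first by case.
have {}IH := IH (eqXW (leqnSn n) h) (eqXW (leqnSn n) h').
by apply: eqX_primitive h0 _;
  apply/(eqX_trans h)/(eqX_trans (eqXMl g IH))/eqX_sym.
Qed.

Lemma eqX_exp0 n p : p`_0 = 0 -> eqX n (p ^+ n) 0.
Proof.
move=> p0; have /factor_theorem[r ->] : root p 0.
  by rewrite /root horner_coef0 p0.
by rewrite subr0 exprMn => i lin; rewrite coefMXn lin coef0.
Qed.

Definition exp_poly n : {poly F} := \poly_(i < n.+1) i`!%:R^-1.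

Lemma exp_poly0 n : (exp_poly n)`_0 = 1.
Proof. by rewrite coef_poly /= fact0 invr1. Qed.

Lemma coef0_comp p r : r`_0 = 0 -> (p \Po r)`_0 = p`_0.
Proof. by move=> r0; rewrite -!horner_coef0 horner_comp (horner_coef0 r) r0.
  Qed.

Lemma natf_neq0S n : n.+1%:R != 0 :> F. Proof. by rewrite pnatr_eq0. Qed.
Lemma factf_neq0 n : n`!%:R != 0 :> F.
Proof. by rewrite pnatr_eq0 -lt0n fact_gt0. Qed.

Lemma deriv_exp_poly n : (exp_poly n.+1)^`() = exp_poly n.
Proof.
apply/polyP => i; rewrite coef_deriv !coef_poly ltnS.
case: ifP => _; last by rewrite mul0rn.
rewrite -[LHS]mulr_natr factS natrM invfM mulrAC mulVf ?natf_neq0S ?mul1r //.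
Qed.

Lemma exp_polyS n :
  exp_poly n.+1 = exp_poly n + (n.+1)`!%:R^-1 *: 'X^(n.+1).
Proof.
apply/polyP => i; rewrite coefD coefZ coefXn !coef_poly ltnS.
rewrite [(i <= n.+1)%N]leq_eqVlt ltnS; have [->|_] := eqVneq i n.+1.
  by rewrite ltnn add0r mulr1.
by rewrite mulr0 addr0.
Qed.

(** Differentiation drops the last term of the truncated exponential, a multiple of [p ^+ n], which
    vanishes modulo ['X^n]. *)
Lemma exp_poly_ode n p : p`_0 = 0 ->
  eqX n (exp_poly n \Po p)^`() (p^`() * (exp_poly n \Po p)).
Proof.
case: n => [//|n] p0; rewrite deriv_comp deriv_exp_poly mulrC.
apply: eqXMl => i lin.
rewrite exp_polyS comp_polyD comp_polyZ comp_Xn_poly coefD coefZ.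
by rewrite (eqX_exp0 p0) // coef0 mulr0 addr0.
Qed.

Lemma exp_ode_unique n g a : g`_0 = 0 -> a`_0 = 1 ->
  eqX n a^`() (g^`() * a) -> eqX n.+1 a (exp_poly n \Po g).
Proof.
move=> g0 a0 h; apply: (linear_ode_unique _ h (exp_poly_ode g0)).
by rewrite coef0_comp // exp_poly0.
Qed.

Definition log_poly n : {poly F} := \poly_(i < n.+1) ((-1) ^+ i.-1 / i%:R).

(** The derivative of [log_poly n] is a finite geometric series, so the factor [1 + p] collapses it
    to [1 - (- p) ^+ n], and [(- p) ^+ n] vanishes modulo ['X^n]. *)
Lemma log_poly_ode n p : p`_0 = 0 ->
  eqX n ((1 + p) * (log_poly n \Po p)^`()) p^`().
Proof.
case: n => [//|n] p0; rewrite deriv_comp.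
have -> : (log_poly n.+1)^`() = \poly_(i < n.+1) (-1) ^+ i.
  apply/polyP => i; rewrite coef_deriv !coef_poly ltnS.
  by case: ifP => _; rewrite ?mul0rn // -[LHS]mulr_natr divfK ?natf_neq0S.
rewrite mulrA; have -> : (1 + p) * (\poly_(i < n.+1) (-1) ^+ i \Po p) =
    1 - (- p) ^+ n.+1.
  rewrite -[1 in RHS](expr1n _ n.+1) subrXX opprK; congr (_ * _).
  rewrite poly_def rmorph_sum; apply: eq_bigr => i _ /=.
  by rewrite comp_polyZ comp_Xn_poly expr1n mul1r -[- p]scaleN1r exprZn.
rewrite mulrBl mul1r -[X in eqX _ _ X]subr0; apply: eqXB => //.
rewrite -[0](mul0r p^`()); apply: eqXMr; apply: eqX_exp0.
by rewrite coefN p0 oppr0.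
Qed.

Lemma log_ode_unique n g a p : g`_0 = 0 -> p`_0 = 0 -> eqX n.+1 a (1 + p) ->
  eqX n a^`() (g^`() * a) -> eqX n.+1 g (log_poly n \Po p).
Proof.
move=> g0 p0 ap h; apply: eqX_primitive.
  by rewrite coef0_comp // g0 coef_poly invr0 mulr0.
apply: (@eqX_cancel _ (1 + p)); first by rewrite coefD p0 coef1 addr0 oner_neq0.
apply: (eqX_trans _ (eqX_sym (log_poly_ode p0))).
have -> : p^`() = (1 + p)^`() by rewrite derivD derivC add0r.
apply: (eqX_trans _ (eqX_deriv ap)); apply: eqX_sym.
by apply: (eqX_trans h); rewrite mulrC; apply: eqXMr; apply: eqXW ap.
Qed.

(** Truncation of [X / (exp X - 1)]. *)
Definition bernoulli_poly n : {poly F} :=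
  \poly_(i < n) (ratr (bernoulli i) / i`!%:R).

Lemma bernoulli_poly_egf n :
  eqX n (bernoulli_poly n * \poly_(i < n) (i.+1)`!%:R^-1) 1.
Proof.
move=> i lin; rewrite coefM coef1.
have -> : (i == 0)%:R = i.+1`!%:R^-1 *
    ratr (\sum_(j < i.+1) 'C(i.+1, j)%:R * bernoulli j) :> F.
  by rewrite bernoulli_rec; case: i lin => [|i] _;
    rewrite ?ratr_nat ?rmorph0 ?mulr0 // invr1 mulr1.
rewrite rmorph_sum big_distrr; apply: eq_bigr => j _ /=.
have ji : (j <= i)%N by rewrite -ltnS.
rewrite !coef_poly !(leq_ltn_trans _ lin) ?leq_subr //.
rewrite rmorphM /= ratr_nat -subSn //.
have -> : i.+1`!%:R = 'C(i.+1, j)%:R * (j`!%:R * (i.+1 - j)`!%:R) :> F.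
  by rewrite -!natrM bin_fact // leqW.
have := factf_neq0 j; have := factf_neq0 (i.+1 - j).
have : 'C(i.+1, j)%:R != 0 :> F by rewrite pnatr_eq0 -lt0n bin_gt0 leqW.
by move=> *; field; rewrite ?invr_neq0 //; do ?[apply/andP; split].
Qed.

(* The logarithm of [(exp (X / 2) - exp (- X / 2)) / X]. *)
Definition log_sinh_poly n : {poly F} :=
  \poly_(i < n) (if (1 < i)%N then ratr (bernoulli i) / i%:R / i`!%:R else 0).

(** Here [v] truncates [(exp X - 1) / X], and [X] times its logarithmic derivative is
    [X / (exp X - 1) + X - 1]. *)
Lemma exp_sub1_ode n :
  let v : {poly F} := \poly_(i < n.+1) (i.+1)`!%:R^-1 in
  eqX n v^`() ((2^-1%:P + (log_sinh_poly n.+1)^`()) * v).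
Proof.
move=> v; apply: eqX_cancelX.
have Xv : 'X * v = exp_poly n.+1 - 1.
  apply/polyP => -[|i]; rewrite coefXM coefB coef1 !coef_poly /=.
    by rewrite fact0 invr1 subrr.
  by rewrite !ltnS subr0.
have dXv : v + 'X * v^`() = 1 + 'X * v - n.+1`!%:R^-1 *: 'X^(n.+1).
  have := congr1 (@deriv _) Xv; rewrite derivM derivX mul1r => ->.
  rewrite derivB derivC subr0 deriv_exp_poly Xv exp_polyS.
  ring.
have {}dXv : eqX n.+1 (v + 'X * v^`()) (1 + 'X * v).
  rewrite dXv -[X in eqX _ _ X]subr0; apply: eqXB => // i lin.
  by rewrite coefZ coefXn ltn_eqF // mulr0 coef0.
(* The coefficient of [X] is [B_1 + 1 = 1/2]. It is the separate constant on the right, which is why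
   [log_sinh_poly] skips the index 1. *)
have bE : eqX n.+1 (bernoulli_poly n.+1 + 'X - 1)
                   ('X * (2^-1%:P + (log_sinh_poly n.+1)^`())).
  move=> i lin; rewrite coefB coefD coefX coef1 coefXM coefD coefC coef_deriv.
  rewrite !coef_poly lin.
  case: i lin => [|[|i]] lin /=.
  - by rewrite bernoulli0 rmorph1 fact0 divr1 addr0 subrr.
  - rewrite lin bernoulli1 rmorphN fmorphV rmorph_nat /= mul0rn !addr0 subr0
    divr1.
    by field.
  - by rewrite lin !addr0 subr0 add0r -[RHS]mulr_natr [RHS]mulrAC divfK
    ?natf_neq0S.
rewrite mulrA; apply: (eqX_trans _ (eqXMr v bE)).
have := eqXB dXv (eqX_refl v).
rewrite addrAC subrr add0r => /eqX_trans; apply.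
rewrite mulrBl mulrDl mul1r; apply: eqXB => //; apply: eqXD => //.
exact/eqX_sym/bernoulli_poly_egf.
Qed.

(* [r] stands for the moment series and [exp a] for the exponential of the *)
(* mock Eisenstein series; multiplying by [X * exp (X / 2)] clears the     *)
(* quotient [(exp (X / 2) - exp (- X / 2)) / X].                           *)
Lemma moment_series_ode n r a u : u`_0 = 1 -> eqX n u^`() (a^`() * u) ->
  eqX n.+2 ('X * ((exp_poly n.+1 \Po (2^-1%:P * 'X)) * r))
           ((exp_poly n.+1 - 1) * u) ->
  r`_0 = 1 /\ eqX n r^`() ((a + log_sinh_poly n.+1)^`() * r).
Proof.
move=> u0 uE; pose v : {poly F} := \poly_(i < n.+1) (i.+1)`!%:R^-1.
have -> : exp_poly n.+1 - 1 = 'X * v.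
  apply/polyP => -[|i]; rewrite coefXM coefB coef1 !coef_poly /=.
    by rewrite fact0 invr1 subrr.
  by rewrite !ltnS subr0.
(* Cancelling ['X] costs one order and the differentiation below another, hence the hypothesis at
   [n.+2]. *)
rewrite -mulrA; set e := exp_poly _ \Po _ => /eqX_cancelX erE.
have h0 : (2^-1%:P * 'X : {poly F})`_0 = 0 by rewrite coefCM coefX mulr0.
have e0 : e`_0 = 1 by rewrite coef0_comp // exp_poly0.
have v0 : v`_0 = 1 by rewrite coef_poly /= invr1.
have r0 : r`_0 = 1.
  have := erE 0%N isT; rewrite !coefM !big_ord1 /= e0 v0 u0 !mul1r.
  by [].
split=> //; apply: (@eqX_cancel _ e); first by rewrite e0 oner_neq0.
have eE : eqX n e^`() (2^-1%:P * e).
  have := exp_poly_ode h0; rewrite derivM derivC mul0r add0r derivX mulr1 => h.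
  exact: eqXW (leqnSn n) (h n.+1).
(* Since [e' = e / 2], the term [e' * r] cancels the constant [1/2] of [exp_sub1_ode]. *)
have -> : e * r^`() = (e * r)^`() - e^`() * r by rewrite derivM; ring.
have -> : e * ((a + log_sinh_poly n.+1)^`() * r) =
    (2^-1%:P + (log_sinh_poly n.+1)^`() + a^`()) * (e * r) - 2^-1%:P * e * r.
  by rewrite derivD; ring.
apply: eqXB; last exact: eqXMr.
apply: (eqX_trans (eqX_deriv erE)).
apply: (eqX_trans _ (eqXMl _ (eqX_sym (eqXW (leqnSn n) erE)))).
rewrite derivM mulrDl !mulrA.
apply: eqXD; first exact/eqXMr/exp_sub1_ode.
by rewrite -mulrA mulrCA; apply: eqXMl.
Qed.
End TruncatedSeries.

(** * Partition traces as coefficients of exponentials and logarithms *)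

Section PartitionTraces.
Variable F : numFieldType.
Implicit Types (p r s u a g : {poly F}) (n : nat).

Let dpow n a := n`!%:R^-1 *: a ^+ n.

(** The product lives in [{poly {poly F}}]. With outer variable Y it says that the product of the
    [exp (a_i Y)] is the exponential of the sum, up to [Y^N]; divided powers keep multinomial
    coefficients out. *)
Lemma coef_prod_dpow N (I : Type) (s : seq I) (a : I -> {poly F}) n :
  (n <= N)%N ->
  (\prod_(i <- s) \poly_(j < N.+1) dpow j (a i))`_n = dpow n (\sum_(i <- s) a
    i).
Proof.
elim: s n => [|i s IH] n nN.
  rewrite !big_nil coef1 /dpow expr0n; case: n nN => [|n] _ /=.
    by rewrite fact0 invr1 scale1r.
  by rewrite scaler0.
rewrite !big_cons coefM /dpow addrC exprDn scaler_sumr; apply: eq_bigr => j _.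
have jn : (j <= n)%N by rewrite -ltnS.
rewrite IH; last exact: leq_trans (leq_subr _ _) nN.
rewrite coef_poly ltnS (leq_trans jn nN) /dpow.
rewrite -[LHS]scalerAl -[X in _ *: X = _]scalerAr [LHS]scalerA -[X in _ = _ *:
  X]scaler_nat [RHS]scalerA.
rewrite [X in _ = _ *: X]mulrC; congr (_ *: _).
have -> : n`!%:R = 'C(n, j)%:R * (j`!%:R * (n - j)`!%:R) :> F.
  by rewrite -!natrM bin_fact.
have := factf_neq0 F j; have := factf_neq0 F (n - j).
have : 'C(n, j)%:R != 0 :> F by rewrite pnatr_eq0 -lt0n bin_gt0.
by move=> *; field; do ?[apply/andP; split].
Qed.

Lemma dpow_sum N (I : finType) (a : I -> {poly F}) n : (n <= N)%N ->
  dpow n (\sum_i a i) =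
  \sum_(m : {ffun I -> 'I_N.+1} | (\sum_i m i)%N == n) \prod_i dpow (m i) (a i).
Proof.
move=> nN; rewrite -(coef_prod_dpow _ _ nN).
under eq_bigr do rewrite poly_def.
rewrite bigA_distr_bigA coef_sum [RHS]big_mkcond; apply: eq_bigr => m _ /=.
under eq_bigr do rewrite -mul_polyC.
rewrite big_split /= -rmorph_prod /= prodrXr coefCM coefXn eq_sym.
by case: eqP; rewrite ?mulr1 ?mulr0.
Qed.

Lemma coef_dpow_partitions k (x : nat -> F) n :
  (dpow n (\sum_(i < k) x i *: 'X^(i.+1)))`_k =
  \sum_(m in partitions k | nparts m == n)
     \prod_(i < k) (x i ^+ m i / (m i)`!%:R).
Proof.
(* For [n > k] both sides are zero: a partition of [k] has at most [k] parts, and ['X^n] divides the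
   left polynomial. *)
have [nk|kn] := leqP n k; last first.
  rewrite [RHS]big_pred0 => [|m]; last first.
    by apply/negbTE/negP => /andP[/nparts_leq mk /eqP mn];
      rewrite leqNgt mn kn in mk.
  rewrite coefZ (@eqX_exp0 _ n) ?coef0 ?mulr0 //.
  by rewrite coef_sum big1 // => i _; rewrite coefZ coefXn mulr0.
rewrite (dpow_sum _ nk) coef_sum.
rewrite big_mkcond [RHS]big_mkcond; apply: eq_bigr => m _ /=.
rewrite /dpow /nparts inE andbC; case: ifP => //= _.
under eq_bigr => i _ do
  rewrite exprZn scalerA mulrC -exprM -mul_polyC.
rewrite big_split /= -rmorph_prod /= prodrXr coefCM coefXn eq_sym.
by case: eqP; rewrite ?mulr0 // mulr1.
Qed.

(** A form of the formula of Faa di Bruno: partitions are sorted by their number of parts, which is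
    the exponent of the inner polynomial. *)
Lemma coef_comp_partitions K k (c x : nat -> F) : (k <= K)%N ->
  (\poly_(n < K.+1) (c n / n`!%:R) \Po \sum_(i < k) x i *: 'X^(i.+1))`_k =
  \sum_(m in partitions k)
     c (nparts m) * \prod_(i < k) (x i ^+ m i / (m i)`!%:R).
Proof.
move=> kK; set P := \sum_(i < k) _.
rewrite poly_def rmorph_sum coef_sum /=.
rewrite (partition_big (fun m => inord (nparts m) : 'I_K.+1) xpredT) //=.
apply: eq_bigr => n _.
rewrite comp_polyZ comp_Xn_poly -scalerA -/(dpow n P) coefZ.
rewrite coef_dpow_partitions big_distrr /=;
  apply: eq_big => [m|m /andP[_ /eqP->] //].
apply: andb_id2l => /nparts_leq mk.
by rewrite -val_eqE /= inordK // ltnS (leq_trans mk kK).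
Qed.

Lemma partition_trace_phiM k (X : nat -> F) K : (k <= K)%N ->
  partition_trace (@phiM k) X = (2 * k)`!%:R *
    (exp_poly F K \Po
       \sum_(i < k) (2 * X i.+1 / (2 * i.+1)`!%:R) *: 'X^(i.+1))`_k.
Proof.
move=> kK; have -> : exp_poly F K = \poly_(n < K.+1) (1 / n`!%:R).
  by rewrite /exp_poly; under [RHS]eq_poly do rewrite mul1r.
rewrite (coef_comp_partitions (fun=> 1) (fun i =>
  2 * X i.+1 / (2 * i.+1)`!%:R)) //.
rewrite big_distrr; apply: eq_bigr => m _ /=.
rewrite /phiM rmorphM /= ratr_nat -mulrA mul1r; congr (_ * _).
rewrite rmorph_prod -big_split /=; apply: eq_bigr => i _.
rewrite rmorphM /= fmorphV rmorphM /= !rmorphXn /= !ratr_nat.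
rewrite !exprMn exprVn.
have := factf_neq0 F (m i); have := factf_neq0 F (2 * i.+1).
by move=> *; field; do ?[apply/andP; split]; rewrite ?expf_neq0.
Qed.

Lemma partition_trace_phiS k (X : nat -> F) K : (0 < k <= K)%N ->
  partition_trace (@phiS k) X = (2 * k)`!%:R / 2 *
    (log_poly F K \Po \sum_(i < k) (X i.+1 / (2 * i.+1)`!%:R) *: 'X^(i.+1))`_k.
Proof.
move=> /andP[k0 kK].
(* These are [n!] times the coefficients of [log (1 + X)]. The value 0 at [n = 0] matches
   [log_poly], where the division by zero gives 0. *)
pose c n : F := if n is n'.+1 then (-1) ^+ n' * n'`!%:R else 0.
have -> : log_poly F K = \poly_(n < K.+1) (c n / n`!%:R).
  apply/polyP => -[|i]; rewrite !coef_poly //=;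
    first by rewrite invr0 mulr0 mul0r.
  case: ifP => // _; rewrite factS natrM.
  by rewrite invfM [X in _ = _ * X]mulrC mulrA mulfK ?factf_neq0.
rewrite (coef_comp_partitions c (fun i => X i.+1 / (2 * i.+1)`!%:R)) //.
rewrite big_distrr; apply: eq_bigr => m mk /=.
(* A partition of [k > 0] has a part, so the predecessors in [phiS] are genuine. *)
have : (0 < nparts m)%N.
  rewrite lt0n; apply/eqP => m0; move: mk k0; rewrite inE => /eqP <-.
  move/eqP: m0; rewrite sum_nat_eq0 => /forall_inP m0.
  by rewrite big1 // => i _; rewrite (eqP (m0 i _)) ?muln0.
rewrite /phiS /c; case: (nparts m) => //= n _.
rewrite !rmorphM /= fmorphV rmorph_prod /= !rmorphXn rmorphN1 /= !ratr_nat.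
rewrite -!mulrA; congr (_ * (_ * (_ * (_ * _)))).
rewrite -big_split /=; apply: eq_bigr => i _.
rewrite fmorphV rmorphM /= !rmorphXn /= !ratr_nat !exprMn exprVn.
have := factf_neq0 F (m i); have := factf_neq0 F (2 * i.+1).
by move=> *; field; do ?[apply/andP; split]; rewrite ?expf_neq0.
Qed.

Lemma traces_of_ode k r g : (0 < k)%N -> r`_0 = 1 -> g`_0 = 0 ->
  (forall i, odd i -> r`_i = 0) ->
  eqX (2 * k) r^`() (g^`() * r) ->
  (2 * k)`!%:R * r`_(2 * k) =
    partition_trace (@phiM k) (fun j => (2 * j)`!%:R / 2 * g`_(2 * j)) /\
  (2 * k)`!%:R / 2 * g`_(2 * k) =
    partition_trace (@phiS k) (fun j => (2 * j)`!%:R * r`_(2 * j)).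
Proof.
move=> k0 r0 g0 rodd rg.
have coef2 p i : (p \Po 'X^2)`_(2 * i) = p`_i.
  by rewrite coef_comp_poly_Xn // dvdn_mulr // mulKn.
have coefodd p i : odd i -> (p \Po 'X^2)`_i = 0.
  by move=> oi; rewrite coef_comp_poly_Xn // dvdn2 oi.
pose P (y : nat -> F) : {poly F} := \sum_(i < k) y i *: 'X^(i.+1).
have P0 y : (P y)`_0 = 0.
  by rewrite coef_sum big1 // => i _; rewrite coefZ coefXn mulr0.
have PX0 y : (P y \Po 'X^2)`_0 = 0 by rewrite (coef2 _ 0%N) P0.
have coefP y i : (i < k)%N -> (P y)`_i.+1 = y i.
  move=> ik; rewrite coef_sum (bigD1 (Ordinal ik)) //= coefZ coefXn eqxx mulr1.
  rewrite big1 ?addr0 // => j; rewrite -val_eqE /= => ji.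
  by rewrite coefZ coefXn eqSS eq_sym (negPf ji) mulr0.
have evenE p y : p`_0 = 0 -> (forall i, (i <= 2 * k)%N -> odd i -> p`_i = 0) ->
    (forall i, y i = p`_(2 * i.+1)) -> eqX (2 * k).+1 p (P y \Po 'X^2).
  move=> p0 podd yE i; rewrite ltnS => ik.
  have [oi|/even_halfK] := boolP (odd i); first by rewrite podd // coefodd.
  rewrite -mul2n => iE; rewrite -iE coef2; case: i./2 iE ik => [|j] iE ik.
    by rewrite muln0 p0 P0.
  by rewrite coefP ?yE //; lia.
(* The logarithm comes first: it shows that [g] is a series in [X^2] up to this order, and only then
   can [g] be rewritten in the form required for the exponential. *)
have gL : eqX (2 * k).+1 g
    (log_poly F (2 * k) \Po P (fun i => r`_(2 * i.+1)) \Po 'X^2).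
  rewrite -comp_polyA; apply: log_ode_unique rg => //.
  have h : eqX (2 * k).+1 (r - 1) (P (fun i => r`_(2 * i.+1)) \Po 'X^2).
    apply: evenE => [|i ik oi|i]; first by rewrite coefB coef1 r0 subrr.
      by rewrite coefB coef1 rodd // sub0r; case: i oi {ik} => // i _;
        rewrite oppr0.
    by rewrite coefB coef1 subr0.
  by have := eqXD (eqX_refl 1) h; rewrite addrC subrK.
have godd i : (i <= 2 * k)%N -> odd i -> g`_i = 0.
  by move=> ik oi; rewrite gL // coefodd.
have gE := evenE g (fun i => g`_(2 * i.+1)) g0 godd (fun=> erefl).
split; last first.
  rewrite gL // coef2 (@partition_trace_phiS _ _ (2 * k)) ?k0 ?leq_pmull //.
  congr (_ * (_ \Po _)`__); apply: eq_bigr => i _.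
  by rewrite mulrAC divff ?mul1r ?factf_neq0.
rewrite (@partition_trace_phiM _ _ (2 * k)) ?leq_pmull //; congr (_ * _).
have := @exp_ode_unique F (2 * k) (P (fun i => g`_(2 * i.+1)) \Po 'X^2) r.
move=> /(_ _ r0) ->//.
  rewrite comp_polyA coef2; congr ((_ \Po _)`__); apply: eq_bigr => i _.
  congr (_ *: _); have := factf_neq0 F (2 * i.+1).
  by move=> *; field.
apply: (eqX_trans rg); apply/eqXMr/eqX_deriv/gE.
Qed.
End PartitionTraces.

Local Open Scope classical_set_scope.
Local Open Scope complex_scope.
Local Open Scope ring_scope.

(** * Complex series and the exponential *)

Section ComplexSeries.
Variable R : realType.
Implicit Types (u : nat -> R[i]).

Lemma normC_le_ReIm (z : R[i]) :
  `|z| <= (`|complex.Re z| + `|complex.Im z|)%:C.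
Proof.
rewrite {1}[z]complexE (le_trans (ler_normD _ _)) // normrM.
have -> : `|'i%C : R[i]| = 1 by rewrite normc_def /= expr0n expr1n add0r sqrtr1.
rewrite mul1r !normc_def /= !expr0n /= !addr0 !sqrtr_sqr.
by rewrite rmorphD.
Qed.

Lemma normC_Im_le (z : R[i]) : `|complex.Im z|%:C <= `|z|.
Proof.
rewrite -normrN -ReiNIm; apply: (le_trans (normc_ge_Re _)); rewrite normrM.
have -> : `|'i%C : R[i]| = 1 by rewrite normc_def /= expr0n expr1n add0r sqrtr1.
by rewrite mulr1.
Qed.

Lemma posC_real (e : R[i]) : 0 < e -> exists2 r : R, 0 < r & e = r%:C.
Proof.
case: e => a b; rewrite ltcE /= => /andP[/eqP -> a0]; by exists a.
Qed.

Lemma cvgC_ReIm u (a b : R) :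
  (fun n => complex.Re (u n)) @ \oo --> a ->
  (fun n => complex.Im (u n)) @ \oo --> b -> u @ \oo --> a +i* b.
Proof.
move=> /cvgrPdist_lt ua /cvgrPdist_lt ub;
  apply/cvgrPdist_lt => _ /posC_real[e e0 ->].
have e20 : 0 < e / 2 by lra.
have [N _ hN] := ua _ e20; have [M _ hM] := ub _ e20.
exists (maxn N M) => // n /=; rewrite geq_max => /andP[Nn Mn].
have h1 := hN _ Nn; have h2 := hM _ Mn.
apply: (le_lt_trans (normC_le_ReIm _)); rewrite ltcR /=.
by case: (u n) h1 h2 => x y /= h1 h2; rewrite [e]splitr ltrD.
Qed.

Lemma Re_series u :
  (fun n => complex.Re (series u n)) = series (fun n => complex.Re (u n)).
Proof. by apply/funext => n; rewrite /series /= raddf_sum. Qed.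

Lemma Im_series u :
  (fun n => complex.Im (series u n)) = series (fun n => complex.Im (u n)).
Proof. by apply/funext => n; rewrite /series /= raddf_sum. Qed.

Lemma lim_dist_le u l N (b : R) : series u @ \oo --> l ->
  (forall m, (N <= m)%N -> `|series u m - series u N| <= b%:C) ->
  `|l - series u N| <= b%:C.
Proof.
move=> /cvgrPdist_lt ul ub; rewrite normc_def lecR.
apply/ler_addgt0Pr => e e0; have e0C : 0 < e%:C by rewrite ltcR.
have [M _ hM] := ul _ e0C; rewrite -lecR -normc_def.
have h1 := hM _ (leq_maxl M N); have h2 := ub _ (leq_maxr M N).
rewrite -(subrK (series u (maxn M N)) l) -addrA rmorphD addrC.
by apply: (le_trans (ler_normD _ _)); rewrite lerD // ltW.
Qed.

Lemma series_sub_norm_le u (w : nat -> R) N m : (N <= m)%N ->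
  (forall n, (N <= n)%N -> `|u n| <= (w n)%:C) ->
  `|series u m - series u N| <= (\sum_(N <= n < m) w n)%:C.
Proof.
move=> Nm uw; rewrite sub_series Nm rmorph_sum.
apply: (le_trans (ler_norm_sum _ _ _)); apply: ler_sum_nat => n /andP[Nn _].
exact: uw.
Qed.

Lemma geometric_sum_le (k x : R) N m : 0 <= k -> 0 <= x < 1 ->
  \sum_(N <= n < m) k * x ^+ n <= k * x ^+ N / (1 - x).
Proof.
move=> k0 /andP[x0 x1]; have x1' : 0 < 1 - x by rewrite subr_gt0.
have [Nm|mN] := leqP N m; last first.
  by rewrite big_geq ?(ltnW mN) // divr_ge0 ?mulr_ge0 ?exprn_ge0 // ltW.
rewrite -big_distrr /= -mulrA ler_wpM2l // ler_pdivlMr // mulrC mulr_sumr.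
under eq_bigr do rewrite mulrBl mul1r -exprS.
rewrite (@telescope_sumr_eq _ _ _ (fun n => - x ^+ n)) //; last first.
  by move=> n _; rewrite opprK addrC.
by rewrite opprK gerDr oppr_le0 exprn_ge0.
Qed.

(** Real and imaginary parts converge by comparison with a real geometric series. The tail bound
    supplies the constants of [rank_gf_jet] and [power_series_jet]. *)
Lemma geometric_dominated u (k x : R) : 0 <= k -> 0 <= x < 1 ->
  (forall n, `|u n| <= (k * x ^+ n)%:C) ->
  cvgn (series u) /\
  forall N, `|limn (series u) - series u N| <= (k * x ^+ N / (1 - x))%:C.
Proof.
move=> k0 x01 ub; have /andP[x0 x1] := x01.
have cvgR (f : R[i] -> R) : (forall z, `|f z|%:C <= `|z|) ->
    cvgn (series (fun n => f (u n))).
  move=> fle; apply: normed_cvg; apply: (@series_le_cvg _ _ (geometric k x)).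
  - by move=> n; exact: normr_ge0.
  - by move=> n; rewrite mulr_ge0 ?exprn_ge0.
  - by move=> n; rewrite -lecR; exact: le_trans (fle _) (ub n).
  - by apply: is_cvg_geometric_series; rewrite ger0_norm.
have /cvg_ex[a ua] := cvgR _ (@normc_ge_Re _).
have /cvg_ex[b ub'] := cvgR _ normC_Im_le.
have ul : series u @ \oo --> a +i* b.
  by apply: cvgC_ReIm; rewrite ?Re_series ?Im_series.
split; first by apply/cvg_ex; exists (a +i* b).
move=> N; rewrite (cvg_lim (@norm_hausdorff _ _) ul).
apply: lim_dist_le ul _ => m Nm.
apply: (le_trans (series_sub_norm_le Nm (fun n _ => ub n))).
by rewrite lecR geometric_sum_le.
Qed.

(** As [i! <= (N + i)!], a tail term is at most [x^N] times the term of index [i] of the series of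
    [expR x]. *)
Lemma exp_coeff_dominated u (x : R) l : 0 <= x -> 
  (forall n, `|u n| <= (exp_coeff x n)%:C) -> series u @ \oo --> l ->
  forall N, `|l - series u N| <= (x ^+ N * expR x)%:C.
Proof.
move=> x0 ub ul N; apply: lim_dist_le ul _ => m Nm.
apply: (le_trans (series_sub_norm_le Nm (fun n _ => ub n))).
rewrite lecR -{1}[N]add0n big_addn.
apply: (@le_trans _ _ (\sum_(0 <= i < m - N) x ^+ N * exp_coeff x i)).
  apply: ler_sum => i _; rewrite /exp_coeff /= exprD [x ^+ i * _]mulrC -mulrA.
  do 2 (apply: ler_wpM2l; first exact: exprn_ge0).
  rewrite lef_pV2 ?posrE ?ltr0n ?fact_gt0 // ler_nat.
  by rewrite leq_fact // leq_addr.
rewrite -big_distrr /= ler_wpM2l ?exprn_ge0 //.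
apply: nondecreasing_cvgn_le; last exact: is_cvg_series_exp_coeff.
by apply: nondecreasing_series => i _ _; exact: exp_coeff_ge0.
Qed.

(** On the axes the complex series reduces to the real series of [expR], or of [cos] and [sin], from
    which [cexp] is built. *)
Lemma cexp_series (v : R[i]) :
   complex.Re v = 0 \/ complex.Im v = 0 ->
   series (fun n => v ^+ n / n`!%:R) @ \oo --> cexp v.
Proof.
have fC n : (n`!%:R : R[i])^-1 = (n`!%:R^-1)%:C by rewrite fmorphV rmorph_nat.
have iX n : ('i%C : R[i]) ^+ n = ((~~ odd n)%:R * (-1) ^+ n./2)
                                +i* ((odd n)%:R * (-1) ^+ n.-1./2).
  rewrite -[in LHS](odd_double_half n) -mul2n exprD exprM sqr_i.
  have -> : (-1 : R[i]) ^+ n./2 = ((-1) ^+ n./2)%:C by rewrite rmorphXn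
    rmorphN1.
  case on : (odd n) => /=; last by rewrite expr0 !mul1r mul0r.
  have -> : n.-1./2 = n./2 by rewrite -{1}(odd_double_half n) on /= doubleK.
  by rewrite expr1 mul0r mul1r; simpc.
case: v => x y /= [->|->]; rewrite /cexp /=.
  have vE n : (y*i ^+ n / n`!%:R : R[i]) = cos_coeff y n +i* sin_coeff y n.
    have -> : y*i = 'i%C * y%:C by simpc.
    rewrite exprMn iX -rmorphXn fC; simpc.
    by [].
  rewrite expR0 rmorph1 mul1r; apply: cvgC_ReIm; rewrite ?Re_series ?Im_series.
    rewrite cos.unlock; under eq_fun do rewrite vE /=.
    exact: is_cvg_series_cos_coeff.
  rewrite sin.unlock; under eq_fun do rewrite vE /=.
  exact: is_cvg_series_sin_coeff.
have vE n : ((x +i* 0) ^+ n / n`!%:R : R[i]) = (exp_coeff x n)%:C.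
  by rewrite -[x +i* 0]/(x%:C) -rmorphXn fC -rmorphM.
rewrite cos0 sin0 mulr1; apply: cvgC_ReIm; rewrite ?Re_series ?Im_series.
  under eq_fun do rewrite vE /=; exact: is_cvg_series_exp_coeff.
under eq_fun do rewrite vE /=; apply: cvg_near_cst.
by exists 0%N => // n _; rewrite /series /= big1.
Qed.

Lemma cexp_exp_poly_le (v : R[i]) : complex.Re v = 0 \/ complex.Im v = 0 ->
  forall N, `|cexp v - \sum_(n < N) v ^+ n / n`!%:R| <=
    `|v| ^+ N * (expR (complex.Re `|v|))%:C.
Proof.
move=> v_axis N; have nv : `|v| = (complex.Re `|v|)%:C by rewrite normc_def.
have v0 : 0 <= complex.Re `|v| by rewrite -ler0c -nv.
have h n : `|v ^+ n / n`!%:R| <= (exp_coeff (complex.Re `|v|) n)%:C.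
  rewrite /exp_coeff /= normrM normfV normrX normr_nat [X in X ^+ _]nv.
  by rewrite rmorphM fmorphV rmorph_nat rmorphXn.
have := exp_coeff_dominated v0 h (cexp_series v_axis) N.
by rewrite /series /= big_mkord rmorphM /= rmorphXn /= -nv.
Qed.

End ComplexSeries.

(** * Asymptotic expansions at 0+ *)

Section Jets.
Variable R : realType.
Implicit Types (P Q : {poly R[i]}) (A B : R -> R[i]) (t : R).

Definition near0 (S : R -> Prop) : Prop :=
  exists2 d : R, 0 < d & forall t, 0 < t < d -> S t.

Lemma near0W (S T : R -> Prop) : (forall t, S t -> T t) -> near0 S -> near0 T.
Proof. by move=> ST [d d0 h]; exists d => // t td; apply/ST/h. Qed.

Lemma near0I (S T : R -> Prop) :
  near0 S -> near0 T -> near0 (fun t => S t /\ T t).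
Proof.
move=> [d d0 h] [e e0 h']; exists (Num.min d e).
  by rewrite lt_min d0.
by move=> t /andP[t0]; rewrite lt_min => /andP[td te]; split;
  [apply: h|apply: h'];
  rewrite t0.
Qed.

(** The inequality itself makes [K * x] real and nonnegative, so the constant of a jet may be
    replaced by its modulus. *)
Lemma le_normM (z K x : R[i]) : 0 <= x -> `|z| <= K * x -> `|z| <= `|K| * x.
Proof.
move=> x0 h; have := le_trans (normr_ge0 z) h => /ger0_norm.
by rewrite normrM (ger0_norm x0) => ->.
Qed.

Lemma near0_unit : near0 (fun t => 0 < t%:C <= 1).
Proof.
by exists 1 => // t /andP[t0 t1]; rewrite ltcR t0 -[1]/(1%:C) lecR ltW.
Qed.

Definition jet N A P : Prop := exists K : R[i],
  near0 (fun t => `|A t - P.[t%:C]| <= K * t%:C ^+ N.+1).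

Lemma jet_poly N P : jet N (fun t => P.[t%:C]) P.
Proof.
by exists 0; apply: near0W near0_unit => t _; rewrite subrr normr0 mul0r.
Qed.

Lemma jet_ext N A B P : near0 (fun t => A t = B t) -> jet N A P -> jet N B P.
Proof.
by move=> AB [K h]; exists K; apply: near0W (near0I AB h) => t [<-].
Qed.

Lemma poly_bounded P :
  exists2 K : R[i], 0 <= K & near0 (fun t => `|P.[t%:C]| <= K).
Proof.
exists (\sum_(i < size P) `|P`_i|); first exact: sumr_ge0.
apply: near0W near0_unit => t /andP[t0 t1].
rewrite horner_coef; apply: (le_trans (ler_norm_sum _ _ _)).
apply: ler_sum => i _; rewrite normrM normrX (gtr0_norm t0).
by rewrite ler_piMr // exprn_ile1 // ltW.
Qed.

Lemma jet_bounded N A P : jet N A P ->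
  exists2 K : R[i], 0 <= K & near0 (fun t => `|A t| <= K).
Proof.
move=> [K h]; have [L L0 h'] := poly_bounded P.
exists (`|K| + L); first by rewrite addr_ge0.
apply: near0W (near0I near0_unit (near0I h h')) => t [/andP[t0 t1] [h1 h2]].
rewrite -(subrK P.[t%:C] (A t)); apply: (le_trans (ler_normD _ _)).
rewrite lerD //; have tN : 0 <= t%:C ^+ N.+1 by rewrite exprn_ge0 // ltW.
apply: (le_trans (le_normM tN h1)).
by rewrite ler_piMr // exprn_ile1 // ltW.
Qed.

Lemma jetD N A B P Q : jet N A P -> jet N B Q ->
  jet N (fun t => A t + B t) (P + Q).
Proof.
move=> [K h] [L h']; exists (K + L); apply: near0W (near0I h h') => t [h1 h2].
rewrite hornerD opprD addrACA mulrDl.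
by apply: (le_trans (ler_normD _ _)); rewrite lerD.
Qed.

Lemma jetM N A B P Q : jet N A P -> jet N B Q ->
  jet N (fun t => A t * B t) (P * Q).
Proof.
move=> hA hB; have [M M0 hM] := jet_bounded hB;
  have [L L0 hL] := poly_bounded P.
case: hA hB => KA hA [KB hB]; exists (KA * M + L * KB).
apply: near0W (near0I (near0I hA hB) (near0I hM hL)) => t [[h1 h2] [h3 h4]].
rewrite hornerM.
have -> : A t * B t - P.[t%:C] * Q.[t%:C] =
  (A t - P.[t%:C]) * B t + P.[t%:C] * (B t - Q.[t%:C]) by ring.
apply: (le_trans (ler_normD _ _)); rewrite !normrM mulrDl.
by apply: lerD; [rewrite [KA * M * _]mulrAC|rewrite -[L * KB * _]mulrA];
  apply: ler_pM.
Qed.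

Lemma jetC N (c : R[i]) : jet N (fun=> c) c%:P.
Proof. by apply: jet_ext (jet_poly N c%:P); apply: near0W near0_unit => t;
  rewrite hornerC. Qed.

Lemma jetX N : jet N (fun t => t%:C) 'X.
Proof. by apply: jet_ext (jet_poly N 'X); apply: near0W near0_unit => t;
  rewrite hornerX. Qed.

Lemma jet_horner N A P Q : jet N A P -> jet N (fun t => Q.[A t]) (Q \Po P).
Proof.
move=> hA; elim/poly_ind: Q => [|Q c IH].
  rewrite comp_poly0; apply: jet_ext (jetC N 0); apply: near0W near0_unit => t.
  by rewrite horner0.
rewrite comp_poly_MXaddC.
apply: jet_ext (jetD (jetM IH hA) (jetC N c)).
by apply: near0W near0_unit => t; rewrite hornerMXaddC.
Qed.

Lemma jet_conj N A P :
  jet N A P -> jet N (fun t => (A t)^*%C) (map_poly conjc P).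
Proof.
move=> [K h]; exists K; apply: near0W h => t.
have -> : (map_poly conjc P).[t%:C] = (P.[t%:C])^*%C.
  by rewrite -{1}(conjc_real t) horner_map.
by rewrite -rmorphB normcJ.
Qed.

Lemma le_near0_eq0 (c K : R[i]) : near0 (fun t => `|c| <= K * t%:C) -> c = 0.
Proof.
move=> [d d0 h]; apply/normr0_eq0; rewrite normc_def.
set r := Num.sqrt _; have r0 : 0 <= r by exact: sqrtr_ge0.
have [->//|rn0] := eqVneq r 0.
have {rn0}r0 : 0 < r by rewrite lt_neqAle eq_sym rn0.
pose k := complex.Re `|K|;
  have Kk : `|K| = k%:C by rewrite RRe_real ?normr_real.
have k0 : 0 <= k by rewrite -ler0c -Kk.
(* With [r] the modulus of [c], this choice gives [t * k < r], against [r <= k * t]; the [+ 1]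
   covers [k = 0]. *)
pose t := Num.min (d / 2) (r / (2 * (k + 1))).
have k1 : 0 < 2 * (k + 1) by lra.
have t0 : 0 < t by rewrite lt_min !divr_gt0.
have td : t < d by rewrite gt_min; apply/orP; left; lra.
have tr : t * (2 * (k + 1)) <= r by rewrite -ler_pdivlMr // ge_min lexx orbT.
have tC : 0 <= t%:C :> R[i] by rewrite ler0c ltW.
have := le_normM tC (h t _); rewrite t0 td => /(_ isT).
rewrite normc_def Kk -rmorphM lecR -/r => h2.
suff : t * k < r by rewrite ltNge mulrC h2.
by apply: lt_le_trans tr; rewrite ltr_pM2l //; lra.
Qed.

(** Letting t tend to 0 kills the constant coefficient; dividing by ['X] then lowers the order by
    one. *)
Lemma poly_small_eqX n P (K : R[i]) :
  near0 (fun t => `|P.[t%:C]| <= K * t%:C ^+ n) -> eqX n P 0.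
Proof.
elim: n P => [//|n IH] P h.
have [Q [c PE]] : exists Q c, P = Q * 'X + c%:P.
  by elim/poly_ind: P {h} => [|Q c _]; [exists 0, 0;
    rewrite mul0r addr0|exists Q, c].
have [L L0 hL] := poly_bounded Q.
have c0 : c = 0.
  apply: (@le_near0_eq0 _ (`|K| + L)).
  apply: near0W (near0I near0_unit (near0I h hL)) => t [/andP[t0 t1] [h1 h2]].
  have -> : c = P.[t%:C] - Q.[t%:C] * t%:C by rewrite PE hornerMXaddC addrC
    addKr.
  apply: (le_trans (ler_normB _ _)); rewrite mulrDl; apply: lerD.
    have tn : 0 <= t%:C ^+ n.+1 by rewrite exprn_ge0 // ltW.
    apply: (le_trans (le_normM tn h1)); rewrite ler_wpM2l // exprS.
    by rewrite ler_piMr ?exprn_ile1 // ltW.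
  by rewrite normrM (gtr0_norm t0) ler_wpM2r // ltW.
rewrite PE c0 addr0 in h *.
have /IH hQ : near0 (fun t => `|Q.[t%:C]| <= K * t%:C ^+ n).
  apply: near0W (near0I near0_unit h) => t [/andP[t0 t1]].
  by rewrite hornerMX normrM (gtr0_norm t0) exprSr mulrA ler_pM2r.
by move=> [|i] lin; rewrite coefMX coef0 //= hQ // coef0.
Qed.

Lemma jet_unique N A P Q : jet N A P -> jet N A Q -> eqX N.+1 P Q.
Proof.
move=> [K h] [L h'] i lin.
suff /(_ i lin) : eqX N.+1 (P - Q) 0 by rewrite coefB coef0 => /subr0_eq.
apply: (@poly_small_eqX _ _ (L + K)).
apply: near0W (near0I h h') => t [h1 h2].
have -> : (P - Q).[t%:C] = (A t - Q.[t%:C]) - (A t - P.[t%:C]).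
  by rewrite hornerD hornerN; ring.
by apply: (le_trans (ler_normB _ _)); rewrite mulrDl lerD.
Qed.

(** Two errors add up: the Taylor remainder of [cexp] at [A t], small because [P(0) = 0] gives
    [A t = O(t)], and the replacement of [A] by [P] inside the truncated exponential. *)
Lemma jet_cexp_axis N A P : P`_0 = 0 -> jet N A P ->
  near0 (fun t => complex.Re (A t) = 0 \/ complex.Im (A t) = 0) ->
  jet N (fun t => cexp (A t)) (exp_poly _ N \Po P).
Proof.
move=> P0 hA axis; have [KE hE] := jet_horner (exp_poly _ N) hA.
have [L L0 hL] : exists2 L : R[i], 0 <= L & near0 (fun t => `|A t| <= L * t%:C).
  have /factor_theorem[Q PE] : root P 0 by rewrite /root horner_coef0 P0.
  rewrite subr0 in PE; have [M M0 hM] := poly_bounded Q; case: (hA) => K hK.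
  exists (`|K| + M); first by rewrite addr_ge0.
  apply: near0W (near0I near0_unit (near0I hM hK)) => t [/andP[t0 t1] [h1 h2]].
  rewrite -(subrK P.[t%:C] (A t)) mulrDl; apply: (le_trans (ler_normD _ _)).
  apply: lerD; last by rewrite PE hornerMX normrM (gtr0_norm t0) ler_wpM2r //
    ltW.
  have tN : 0 <= t%:C ^+ N.+1 by rewrite exprn_ge0 // ltW.
  apply: (le_trans (le_normM tN h2)); rewrite ler_wpM2l // exprS.
  by rewrite ler_piMr ?exprn_ile1 // ltW.
have [M M0 hM] := jet_bounded hA.
have Mr : (complex.Re M)%:C = M by apply: RRe_real; rewrite ger0_real.
exists (L ^+ N.+1 * (expR (complex.Re M))%:C + KE).
apply: near0W (near0I (near0I near0_unit axis) (near0I hE (near0I hL hM))).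
move=> t [[/andP[t0 t1] ax] [h1 [h2 h3]]].
rewrite -(subrK (exp_poly R[i] N).[A t] (cexp (A t))) -addrA mulrDl.
apply: (le_trans (ler_normD _ _)); apply: lerD => //.
have := cexp_exp_poly_le ax N.+1.
have -> : (exp_poly R[i] N).[A t] = \sum_(n < N.+1) A t ^+ n / n`!%:R.
  by rewrite horner_poly; apply: eq_bigr => i _; rewrite mulrC.
move=> /le_trans; apply; rewrite mulrAC -exprMn; apply: ler_pM.
- by rewrite exprn_ge0.
- by rewrite ler0c expR_ge0.
- by apply: lerXn2r => //; rewrite nnegrE // mulr_ge0 // ltW.
- by rewrite lecR ler_expR -lecR Mr RRe_real // normr_real.
Qed.

Lemma cexpD (u v : R[i]) : cexp (u + v) = cexp u * cexp v.
Proof.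
case: u v => a b [c d]; rewrite /cexp /= expRD cosD sinD rmorphM /= mulrACA.
by congr (_ * _); simpc; congr (_ +i* _); rewrite addrC.
Qed.

(* The Taylor bound is only available on the two axes, so the real and *)
(* imaginary parts of [A] are exponentiated separately.                *)
Lemma jet_cexp N A P : P`_0 = 0 -> jet N A P ->
  exists2 Q, jet N (fun t => cexp (A t)) Q &
    Q`_0 = 1 /\ eqX N Q^`() (P^`() * Q).
Proof.
move=> P0 hA; have hAc := jet_conj hA.
(* [P1] expands the real part of [A], and [P2] expands ['i] times its imaginary part. *)
pose P1 := 2^-1%:P * (P + map_poly conjc P).
pose P2 := 2^-1%:P * (P - map_poly conjc P).
have Pc0 : (map_poly conjc P)`_0 = 0 by rewrite coef_map_id0 ?P0 ?rmorph0.
have P10 : P1`_0 = 0 by rewrite coefCM coefD Pc0 P0 addr0 mulr0.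
have P20 : P2`_0 = 0 by rewrite coefCM coefB Pc0 P0 subr0 mulr0.
have h1 := jetM (jetC N 2^-1) (jetD hA hAc).
have h2 := jetM (jetC N 2^-1) (jetD hA (jetM (jetC N (-1)) hAc)).
have {}h2 : jet N (fun t => 2^-1 * (A t + -1 * (A t)^*%C)) P2.
  by move: h2; rewrite polyCN mulN1r.
exists ((exp_poly _ N \Po P1) * (exp_poly _ N \Po P2)).
  apply: jet_ext (jetM (jet_cexp_axis P10 h1 _) (jet_cexp_axis P20 h2 _)).
  - apply: near0W near0_unit => t _ /=; rewrite -cexpD; congr cexp.
    by field.
  - apply: near0W near0_unit => t _ /=; right.
    by case: (A t) => x y; rewrite -[2^-1]/(2^-1); simpc.
  - apply: near0W near0_unit => t _ /=; left.
    by case: (A t) => x y; simpc.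
split; first by rewrite coefM big_ord1 /= !coef0_comp // exp_poly0 mulr1.
have -> : P^`() = P1^`() + P2^`().
  rewrite -derivD; congr (_^`()); rewrite -mulrDr addrACA subrr addr0.
  by apply/polyP => i; rewrite coefCM coefD; field.
rewrite derivM mulrDl; apply: eqXD.
  by rewrite mulrA; apply: eqXMr; apply: exp_poly_ode.
by rewrite mulrCA; apply: eqXMl; apply: exp_poly_ode.
Qed.

End Jets.

(** * The rank generating function *)

Section EulerProduct.
Variable R : realType.

(** For [y = x^(i+1) <= x], [1 - y = 1 / (1 + y / (1 - y)) >= exp (- y / (1 - x))], and the
    exponents sum to at most [x / (1 - x)^2], uniformly in [n]. *)
Lemma prod_one_sub_ge (x : R) n : 0 <= x < 1 ->
  expR (- (1 - x)^-2) <= \prod_(i < n) (1 - x ^+ i.+1).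
Proof.
move=> /andP[x0 x1]; have x1' : 0 < 1 - x by rewrite subr_gt0.
apply: (@le_trans _ _ (\prod_(i < n) expR (- (x ^+ i.+1 / (1 - x))))).
  rewrite -expR_sum ler_expR sumrN lerN2 -mulr_suml.
  rewrite -[X in _ <= X]/((1 - x) ^- 2) expr2 invfM ler_wpM2r ?invr_ge0 ?(ltW
    x1') //.
  have := @geometric_sum_le _ x x 0 n x0; rewrite x0 x1 => /(_ isT).
  rewrite big_mkord expr0 mulr1; under eq_bigr do rewrite -exprS.
  move=> /le_trans; apply; rewrite ler_piMl ?invr_ge0 ?ltW //.
apply: ler_prod => i _; rewrite expR_ge0 expRN /=.
have xi : x ^+ i.+1 <= x by rewrite exprS ler_piMr // exprn_ile1 // ltW.
have xi0 : 0 <= x ^+ i.+1 by rewrite exprn_ge0.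
have y1 : 0 < 1 - x ^+ i.+1 by lra.
rewrite -[leRHS]invrK lef_pV2 ?posrE ?expR_gt0 ?invr_gt0 //.
apply: le_trans (expR_ge1Dx _).
have -> : (1 - x ^+ i.+1)^-1 = 1 + x ^+ i.+1 / (1 - x ^+ i.+1).
  by field; lra.
by rewrite lerD2l ler_wpM2l // lef_pV2 ?posrE //; lra.
Qed.

(** Each partition of [n] contributes one term [x^n] to the expanded product of geometric sums; the
    other terms are nonnegative. *)
Lemma card_partitions_le (x : R) n : 0 < x < 1 ->
  #|partitions n|%:R * x ^+ n <= expR ((1 - x)^-2).
Proof.
move=> /andP[x0 x1].
apply: (@le_trans _ _ (\prod_(i < n) (1 - x ^+ i.+1)^-1)); last first.
  rewrite prodfV -[leRHS]invrK -expRN lef_pV2 ?posrE ?expR_gt0 //.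
    by rewrite prod_one_sub_ge // ltW.
  apply: lt_le_trans (prod_one_sub_ge n _); rewrite ?expR_gt0 //.
  by rewrite ltW.
apply: (@le_trans _ _ (\prod_(i < n) \sum_(j < n.+1) (x ^+ i.+1) ^+ j)).
  rewrite bigA_distr_bigA /= (bigID (mem (partitions n))) /=.
  rewrite -[leLHS]addr0 lerD //; last first.
    by apply: sumr_ge0 => m _; apply: prodr_ge0 => i _;
      rewrite !exprn_ge0 // ltW.
  rewrite -sum1_card natr_sum mulr_suml; apply: ler_sum => m.
  rewrite inE => /eqP mn; under [leRHS]eq_bigr do rewrite -exprM.
  by rewrite prodrXr mn mul1r.
apply: ler_prod => i _; rewrite sumr_ge0 => [|j _];
  last by rewrite !exprn_ge0 // ltW.
have y0 : 0 <= x ^+ i.+1 by rewrite exprn_ge0 // ltW.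
have y1 : x ^+ i.+1 < 1 by rewrite exprn_ilt1 // ltW.
have := @geometric_sum_le _ 1 (x ^+ i.+1) 0 n.+1 ler01.
rewrite y0 y1 => /(_ isT); rewrite big_mkord expr0 !mul1r.
by under eq_bigr do rewrite mul1r.
Qed.

Lemma pochhammer_qq (q : R[i]) n :
  pochhammer q q n = \prod_(i < n) (1 - q ^+ i.+1).
Proof.
rewrite /pochhammer big_add1 /= big_mkord.
by apply: eq_bigr => i _; rewrite exprS.
Qed.

(** The lower bound on partial products says nothing about [limn] without convergence, which comes
    from writing them as a series of increments dominated by powers of [x]. *)
Lemma pochhammer_inf_neq0 (q : R[i]) (x : R) : 0 <= x < 1 -> `|q| = x%:C ->
  pochhammer_inf q q != 0.
Proof.
move=> /andP[x0 x1] qx; have x1' : 0 < 1 - x by rewrite subr_gt0.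
have qX i : `|q ^+ i| = (x ^+ i)%:C by rewrite normrX qx rmorphXn.
pose P n : R[i] := \prod_(i < n) (1 - q ^+ i.+1).
have Ple n : `|P n| <= (expR (1 - x)^-1)%:C.
  rewrite normr_prod; apply:
    (@le_trans _ _ (\prod_(i < n) (expR (x ^+ i.+1))%:C)).
    apply: ler_prod => i _; rewrite normr_ge0 /=.
    apply: (le_trans (ler_normB _ _)); rewrite normr1 qX -[1]/(1%:C) -rmorphD.
    by rewrite lecR expR_ge1Dx.
  rewrite -rmorph_prod lecR -expR_sum ler_expR.
  have := @geometric_sum_le _ x x 0 n x0; rewrite x0 x1 => /(_ isT).
  rewrite big_mkord expr0 mulr1; under eq_bigr do rewrite -exprS.
  by move=> /le_trans; apply; rewrite ler_piMl ?invr_ge0 ?ltW.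
have Pge n : (expR (- (1 - x)^-2))%:C <= `|P n|.
  apply: (@le_trans _ _ (\prod_(i < n) (1 - x ^+ i.+1))%:C).
    by rewrite lecR prod_one_sub_ge // x0.
  rewrite rmorph_prod normr_prod; apply: ler_prod => i _.
  rewrite ler0c subr_ge0 exprn_ile1 ?(ltW x1) //=.
  by rewrite rmorphB /= -qX; have := lerB_dist 1 (q ^+ i.+1); rewrite normr1.
pose u n := P n.+1 - P n.
have [|||uc _] := @geometric_dominated _ u (expR (1 - x)^-1 * x) x.
  - by rewrite mulr_ge0 // expR_ge0.
  - by rewrite x0.
  move=> n; rewrite /u /P big_ord_recr /= mulrBr mulr1 addrC addKr normrN
    normrM.
  rewrite qX -mulrA -exprS rmorphM; apply: ler_wpM2r; last exact: Ple.
  by rewrite ler0c exprn_ge0.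
have Pc : cvgn P.
  have -> : P = (fun n => series u n + 1).
    apply/funext => n; rewrite /series /= telescope_sumr //.
    by rewrite {3}/P big_ord0 subrK.
  move: uc => /cvg_ex[l ul]; apply/cvg_ex; exists (l + 1).
  exact: cvgD ul (cvg_cst _).
have PE : pochhammer q q = P by apply/funext => n; rewrite pochhammer_qq.
rewrite /pochhammer_inf PE; apply/eqP => P0.
move: Pc => /cvg_ex[l Pl].
have := Pl; rewrite -(cvg_lim (@norm_hausdorff _ _) Pl) P0 => /cvgrPdist_lt.
move=> /(_ (expR (- (1 - x)^-2))%:C); rewrite ltcR expR_gt0 => /(_ isT).
move=> [N _ /(_ N (leqnn N))] /=; rewrite sub0r normrN.
by move=> /(le_lt_trans (Pge N)); rewrite ltxx.
Qed.

End EulerProduct.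

Lemma cvgC_lin (R : realType) (f g : nat -> R[i]) (a b c : R[i]) :
  f @ \oo --> a -> g @ \oo --> b -> (fun n =>
    f n + c * g n) @ \oo --> a + c * b.
Proof.
move=> /cvgrPdist_lt fa /cvgrPdist_lt gb; apply/cvgrPdist_lt => e e0.
have c0 : 0 < 2 * (`|c| + 1) by rewrite mulr_gt0 // ltr_wpDl.
have [N _ hN] := fa (e / 2) (divr_gt0 e0 (ltr0Sn _ 1)).
have [M _ hM] := gb (e / (2 * (`|c| + 1))) (divr_gt0 e0 c0).
exists (maxn N M) => // n /=; rewrite geq_max => /andP[Nn Mn].
have {hN}h1 := hN _ Nn; have {hM}h2 := hM _ Mn.
rewrite opprD addrACA -mulrBr (le_lt_trans (ler_normD _ _)) // [ltRHS]splitr.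
apply: ltr_leD => //; rewrite normrM.
apply: (@le_trans _ _ (`|c| * (e / (2 * (`|c| + 1)))));
  first (by apply: ler_wpM2l; [exact: normr_ge0|exact: ltW]).
rewrite invfM mulrA mulrCA mulrA ler_pdivrMr ?ltr_wpDl //.
have -> : 2^-1 * (`|c| * e) = e / 2 * `|c| by rewrite mulrCA [LHS]mulrC [2^-1 *
  e]mulrC.
apply: ler_wpM2l; last by rewrite lerDl.
by apply: divr_ge0; [exact: ltW|exact: ler0n].
Qed.

Lemma fsum_rank_count (K : pzRingType) n (g : int -> K) :
  \sum_(r \in [set: int]) (rank_count r n)%:R * g r =
  \sum_(m in partitions n) g (rank m).
Proof.
pose s := undup [seq rank m | m <- enum (partitions n)].
have s_rank m : m \in partitions n -> rank m \in s.
  by move=> mP; rewrite mem_undup map_f // mem_enum.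
rewrite -(@fsbig_widen _ _ _ _ [set` s]) //; last first.
  move=> r [_ /= rs]; have -> : rank_count r n = 0%N; last by rewrite mul0r.
  apply: eq_card0 => m; rewrite inE; apply/negP => /andP[mP /eqP rm].
  by apply: rs; rewrite /= -rm s_rank.
rewrite -fsbig_seq ?undup_uniq //.
under eq_bigr => r _.
  rewrite /rank_count -sum1_card natr_sum mulr_suml.
  under eq_bigr do rewrite mul1r.
  over.
rewrite (exchange_big_dep (mem (partitions n))) /=; last first.
  by move=> r m _; rewrite inE => /andP[].
apply: eq_bigr => m mP.
rewrite big_mkcond (bigD1_seq (rank m)) ?undup_uniq ?s_rank //= inE mP eqxx.
rewrite big1 ?addr0 // => r rm.
by rewrite inE mP /= eq_sym (negPf rm).
Qed.

Section RankGF.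
Variables (R : realType) (q : R[i]) (h : R).
Hypotheses (h0 : 0 < h) (qE : `|q| = (expR (- h))%:C).

Lemma abs_rank_le n (m : {ffun 'I_n -> 'I_n.+1}) : m \in partitions n ->
  `|(rank m)%:~R : R| <= n%:R.
Proof.
move=> mP; rewrite /rank rmorphB /= ler_norml.
have := nparts_leq mP; have := largest_part_leq m.
rewrite -!(ler_nat R) => h1 h2; have := ler0n R (nparts m).
by have := ler0n R (largest_part m); rewrite !pmulrn; lra.
Qed.

(** The bound of [card_partitions_le] at [x = exp (- h / 4)]. *)
Let K0 := expR ((1 - expR (- (h / 4)))^-2).

(* In the decay [|q ^+ n| = exp (- h n)], half of the rate absorbs [f], a *)
(* quarter the number of partitions, and a quarter is left for summation. *)
Lemma sum_partitions_le n (f : {ffun 'I_n -> 'I_n.+1} -> R[i]) (k s : R) :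
  0 <= k -> s <= h / 2 ->
  (forall m, m \in partitions n -> `|f m| <= (k * expR (s * n%:R))%:C) ->
  `|\sum_(m in partitions n) f m * q ^+ n| <=
    (k * K0 * expR (- (h / 4)) ^+ n)%:C.
Proof.
move=> k0 sh fle; apply: (le_trans (ler_norm_sum _ _ _)).
pose e := expR (- (h / 4)).
have e01 : 0 < e < 1 by rewrite expR_gt0 expR_lt1 oppr_lt0 divr_gt0.
apply: (@le_trans _ _ (\sum_(m in partitions n) (k * expR (s * n%:R) * expR (-
  h) ^+ n)%:C)).
  apply: ler_sum => m mP; rewrite normrM normrX qE [leRHS]rmorphM rmorphXn.
  by rewrite ler_wpM2r ?fle // exprn_ge0 // ler0c expR_ge0.
rewrite -rmorph_sum lecR sumr_const -[leLHS]mulr_natr -!mulrA ler_wpM2l //.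
have := card_partitions_le n e01; rewrite -/K0 => hp.
have hs : expR (s * n%:R) * expR (- h) ^+ n <= e ^+ n * e ^+ n.
  rewrite /e -!expRM_natr -!expRD ler_expR -mulrDl -mulrDl.
  by rewrite ler_wpM2r //; lra.
rewrite mulrA; apply: (le_trans (ler_wpM2r (ler0n _ _) hs)).
rewrite mulrC mulrA; apply: ler_wpM2r hp.
by rewrite exprn_ge0 // expR_ge0.
Qed.

Lemma rank_moment_term k n :
  \sum_(r \in [set: int]) r%:~R ^+ k * (rank_count r n)%:R * q ^+ n =
  \sum_(m in partitions n) (rank m)%:~R ^+ k * q ^+ n.
Proof.
rewrite -[RHS](fsum_rank_count n (fun r => r%:~R ^+ k * q ^+ n)).
by apply: eq_fsbigr => r _; rewrite mulrA [_%:R * _]mulrC.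
Qed.

Lemma rank_gf_term zeta n :
  \sum_(r \in [set: int]) (rank_count r n)%:R * zeta ^ r * q ^+ n =
  \sum_(m in partitions n) zeta ^ rank m * q ^+ n.
Proof.
rewrite -[RHS](fsum_rank_count n (fun r => zeta ^ r * q ^+ n)).
by apply: eq_fsbigr => r _; rewrite mulrA.
Qed.

Lemma expr_fact_le (x : R) k : 0 <= x -> x ^+ k <= k`!%:R * expR x.
Proof.
move=> x0; rewrite mulrC -ler_pdivrMr ?ltr0n ?fact_gt0 //.
case: k => [|k]; first by rewrite fact0 divr1 expr0 -expR0 ler_expR.
by apply: le_trans (expR_ge1Dxn k x0); rewrite lerDr.
Qed.

Lemma normC_real (x : R) : `|x%:C| = `|x|%:C.
Proof. by rewrite normc_def /= expr0n addr0 sqrtr_sqr. Qed.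

(** With [s = h / 4], [|rank|^k <= n^k <= (k! / s^k) exp (s n)], within the rate [h / 2] that
    [sum_partitions_le] absorbs. *)
Lemma rank_moment_cvg k : cvgn (series (fun n =>
  \sum_(m in partitions n) (rank m)%:~R ^+ k * q ^+ n)).
Proof.
pose s := h / 4; have s0 : 0 < s by rewrite divr_gt0.
have kK : 0 <= k`!%:R / s ^+ k :> R by rewrite divr_ge0 // exprn_ge0 // ltW.
have e01 : 0 <= expR (- (h / 4)) < 1 by rewrite expR_ge0 expR_lt1 oppr_lt0
  divr_gt0.
have [||//] := @geometric_dominated _ (fun n =>
  \sum_(m in partitions n) (rank m)%:~R ^+ k * q ^+ n) (k`!%:R / s ^+ k * K0) _
    _ e01.
  by rewrite mulr_ge0 // expR_ge0.
move=> n; apply: (@sum_partitions_le n _ _ s) => // [|m mP];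
  first by rewrite /s; move: h0; lra.
rewrite normrX -(rmorph_int (real_complex R)) normC_real -rmorphXn lecR.
have mn : `|(rank m)%:~R| ^+ k <= n%:R ^+ k :> R.
  by rewrite lerXn2r ?nnegrE // abs_rank_le.
apply: (le_trans mn); rewrite mulrAC ler_pdivlMr ?exprn_gt0 // -exprMn mulrC.
by rewrite expr_fact_le // mulr_ge0 // ltW.
Qed.

Lemma cexp_real (t : R) : cexp t%:C = (expR t)%:C.
Proof. by rewrite /cexp /= cos0 sin0 mulr1. Qed.

Lemma cexp_realX (t : R) (z : int) : cexp t%:C ^ z = cexp (t * z%:~R)%:C.
Proof.
rewrite !cexp_real; case: z => n.
  by rewrite -pmulrn expRM_natr rmorphXn.
rewrite NegzE -exprnN mulrNz mulrN expRN -pmulrn expRM_natr fmorphV rmorphXn //.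
Qed.

Lemma cvg_lin_sum N (A : nat -> R[i]) (B : nat -> nat -> R[i]) (c :
  nat -> R[i]) :
  cvgn A -> (forall k, cvgn (B k)) ->
  (fun n => A n + \sum_(k < N) c k * B k n) @ \oo -->
    limn A + \sum_(k < N) c k * limn (B k).
Proof.
move=> /cvg_ex[a Aa] Bc; rewrite (cvg_lim (@norm_hausdorff _ _) Aa).
elim: N => [|N IH].
  by rewrite big_ord0 addr0; under eq_fun do rewrite big_ord0 addr0.
have -> : (fun n => A n + \sum_(k < N.+1) c k * B k n) =
          (fun n => A n + \sum_(k < N) c k * B k n + c N * B N n).
  by apply/funext => n; rewrite big_ord_recr addrA.
have -> : a + \sum_(k < N.+1) c k * limn (B k) =
          a + \sum_(k < N) c k * limn (B k) + c N * limn (B N).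
  by rewrite big_ord_recr addrA.
have /cvg_ex[b Bb] := Bc N; rewrite (cvg_lim (@norm_hausdorff _ _) Bb).
exact: cvgC_lin IH Bb.
Qed.

(** For [t < s = h / 4] the Taylor remainder of [exp (t * rank)] is at most [(t n)^(N+1) exp (t n)].
    The factors [n^(N+1)] and [exp (t n)] each cost [exp (s n)], together exactly the admissible
    rate [h / 2]. *)
Lemma rank_gf_jet N :
  jet N (fun t => rank_gf (cexp t%:C) q)
    (\poly_(k < N.+1) (rank_moment k q / k`!%:R)).
Proof.
pose s := h / 4; have s0 : 0 < s by rewrite divr_gt0.
pose b k n := \sum_(m in partitions n) (rank m)%:~R ^+ k * q ^+ n.
pose a t n := \sum_(m in partitions n) cexp t%:C ^ rank m * q ^+ n.
have e01 : 0 <= expR (- (h / 4)) < 1.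
  by rewrite expR_ge0 expR_lt1 oppr_lt0 divr_gt0.
pose K := N.+1`!%:R / s ^+ N.+1 * K0.
exists (K / (1 - expR (- (h / 4))))%:C; exists s => // t /andP[t0 ts].
have ac : cvgn (series (a t)).
  have [||//] := @geometric_dominated _ (a t) (1 * K0) _ _ e01.
    by rewrite mul1r expR_ge0.
  move=> n; apply: (@sum_partitions_le n _ _ s) => // [|m mP];
    first by rewrite /s; move: h0; lra.
  rewrite cexp_realX cexp_real normC_real lecR mul1r ger0_norm ?expR_ge0 //.
  rewrite ler_expR; have := abs_rank_le mP; rewrite ler_norml => /andP[_ rn].
  apply: (@le_trans _ _ (t * n%:R)); first by rewrite ler_wpM2l // ltW.
  by rewrite ler_wpM2r // ltW.
pose e n := a t n + \sum_(k < N.+1) - (t%:C ^+ k / k`!%:R) * b k n.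
have ec : series e @ \oo --> rank_gf (cexp t%:C) q -
    (\poly_(k < N.+1) (rank_moment k q / k`!%:R)).[t%:C].
  have -> : rank_gf (cexp t%:C) q -
      (\poly_(k < N.+1) (rank_moment k q / k`!%:R)).[t%:C] =
      limn (series (a t)) +
        \sum_(k < N.+1) - (t%:C ^+ k / k`!%:R) * limn (series (b k)).
    rewrite /rank_gf; under eq_fun do rewrite rank_gf_term.
    congr (_ + _); rewrite horner_poly -sumrN; apply: eq_bigr => k _.
    rewrite /rank_moment; under eq_fun do rewrite rank_moment_term.
    by rewrite mulNr mulrC mulrA [in RHS]mulrAC.
  have -> : series e = (fun n => series (a t) n +
       \sum_(k < N.+1) - (t%:C ^+ k / k`!%:R) * series (b k) n).
    apply/funext => n; rewrite /series /e /= big_split /=; congr (_ + _).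
    by rewrite exchange_big; apply: eq_bigr => k _; rewrite big_distrr.
  exact: (@cvg_lin_sum N.+1 (series (a t)) (fun k => series (b k))
    (fun k => - (t%:C ^+ k / k`!%:R)) ac rank_moment_cvg).
have kK : 0 <= N.+1`!%:R / s ^+ N.+1 :> R.
  by rewrite divr_ge0 // exprn_ge0 // ltW.
(* The partial sum at 0 is empty, so this tail bound controls the whole error series. *)
have [|| _ /(_ 0%N)] := @geometric_dominated _ e (t ^+ N.+1 * K) _ _ e01.
- rewrite mulr_ge0 ?exprn_ge0 ?(ltW t0) // /K; apply: mulr_ge0 => //;
  exact: expR_ge0.
- move=> n; have -> : e n = \sum_(m in partitions n)
      (cexp (t * (rank m)%:~R)%:C - \sum_(k < N.+1)
         (t * (rank m)%:~R)%:C ^+ k / k`!%:R) * q ^+ n.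
    rewrite /e /a /b.
    under [X in _ + X]eq_bigr do rewrite big_distrr /=.
    rewrite exchange_big -big_split /=; apply: eq_bigr => m _.
    rewrite cexp_realX mulrBl; congr (_ + _).
    rewrite mulr_suml -sumrN; apply: eq_bigr => k _.
    by rewrite rmorphM rmorph_int exprMn; ring.
  rewrite /K mulrA.
  apply: (@sum_partitions_le n _ _ (h / 2)) => // [|m mP].
    by rewrite mulr_ge0 // exprn_ge0 // ltW.
  have := @cexp_exp_poly_le _ (t * (rank m)%:~R)%:C (or_intror erefl) N.+1.
  move=> /le_trans; apply.
  rewrite normC_real /= -rmorphXn -rmorphM lecR normrM (gtr0_norm t0).
  have rn := abs_rank_le mP; set x := `|_| in rn *.
  have x0 : 0 <= x by exact: normr_ge0.
  have -> : expR (h / 2 * n%:R) = expR (s * n%:R) * expR (s * n%:R).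
    by rewrite -expRD -mulrDl; congr (expR (_ * _)); rewrite /s; field.
  rewrite exprMn -!mulrA ler_wpM2l ?exprn_ge0 ?(ltW t0) //.
  rewrite !mulrA ler_pM ?exprn_ge0 ?expR_ge0 //.
    apply: (@le_trans _ _ (n%:R ^+ N.+1)); first by rewrite lerXn2r ?nnegrE.
    rewrite mulrAC ler_pdivlMr ?exprn_gt0 // -exprMn mulrC.
    by rewrite expr_fact_le // mulr_ge0 // ltW.
  rewrite ler_expR; apply: (@le_trans _ _ (t * n%:R)).
    by rewrite ler_wpM2l // ltW.
  by rewrite ler_wpM2r // ltW.
rewrite /series /= big_geq // subr0 expr0 mulr1 (cvg_lim (@norm_hausdorff _ _)
  ec).
move=> /le_trans; apply.
rewrite -rmorphXn -rmorphM lecR.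
rewrite le_eqVlt; apply/orP; left; apply/eqP. ring.
Qed.
End RankGF.

(** * Identification of the expansions *)

Section Assembly.
Variable R : realType.

Lemma cvg_series_terms_bounded (u : nat -> R[i]) : cvgn (series u) ->
  exists2 M : R, 0 <= M & forall n, `|u n| <= M%:C.
Proof.
move=> /cvg_seq_bounded[M [Mr hM]].
have M1 : M < M + 1 by rewrite ltrDl.
have hs n : `|series u n| <= M + 1 by exact: hM (M + 1) M1 n I.
have Mp : 0 <= M + 1 by exact: le_trans (normr_ge0 _) (hs 0%N).
exists (complex.Re (2 * (M + 1))).
  by rewrite -ler0c RRe_real ?ger0_real // mulr_ge0.
move=> n; rewrite RRe_real; last by rewrite ger0_real // mulr_ge0.
have -> : u n = series u n.+1 - series u n by rewrite seriesSB.
by apply: (le_trans (ler_normB _ _)); rewrite mulr_natl mulr2n lerD.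
Qed.

(** Abel's lemma: convergence at [t1] bounds the terms there, so for [t < t1 / 2] they decay with
    ratio [x = t / t1 <= 1/2], and [1 / (1 - x) <= 2] gives the factor 2. Term [k] carries
    [t^(k+1)], so the first [N] terms fill degree [N]. *)
Lemma power_series_jet N (c : nat -> R[i]) :
  near0 (fun t : R => cvgn (series (fun k => c k * t%:C ^+ k.+1))) ->
  jet N (fun t => limn (series (fun k => c k * t%:C ^+ k.+1)))
    (\poly_(k < N.+1) (if k is l.+1 then c l else 0)).
Proof.
move=> [d d0 hd]; pose t1 := d / 2; have t10 : 0 < t1 by rewrite divr_gt0.
have t1d : t1 < d by rewrite /t1; lra.
have /cvg_series_terms_bounded[M M0 hM] :
  cvgn (series (fun k => c k * t1%:C ^+ k.+1)).
  by apply: hd; rewrite t10.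
exists (2 * M / t1 ^+ N.+1)%:C; exists (t1 / 2); first by rewrite divr_gt0.
move=> t /andP[t0 tt1].
pose x := t / t1; have x0 : 0 <= x by rewrite divr_ge0 // ltW.
have x2 : x <= 2^-1 by rewrite /x ler_pdivrMr //; lra.
have x1 : 0 <= x < 1 by rewrite x0 /=; lra.
have [|| _ /(_ N)] := @geometric_dominated _
    (fun k => c k * t%:C ^+ k.+1) (M * x) x _ x1.
- by rewrite mulr_ge0.
- move=> k; have -> : c k * t%:C ^+ k.+1 =
      c k * t1%:C ^+ k.+1 * (x ^+ k.+1)%:C.
    rewrite rmorphXn -mulrA -exprMn -rmorphM; congr (_ * _%:C ^+ _).
    by rewrite /x mulrC divfK ?gt_eqF.
  rewrite normrM normC_real (ger0_norm (exprn_ge0 _ x0)) -mulrA -exprS.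
  by rewrite [leRHS]rmorphM; apply: ler_wpM2r => //; rewrite ler0c exprn_ge0.
rewrite horner_poly big_ord_recl mul0r add0r /series /= big_mkord.
move=> /le_trans; apply; rewrite -rmorphXn -rmorphM lecR.
rewrite -(mulrA M) -exprS /x expr_div_n.
rewrite ler_pdivrMr; last by rewrite subr_gt0; case/andP: x1.
have -> : 2 * M / t1 ^+ N.+1 * t ^+ N.+1 * (1 - t / t1) =
  (M * (t ^+ N.+1 / t1 ^+ N.+1)) * (2 * (1 - x)) by rewrite /x; ring.
rewrite ler_peMr //; last by lra.
by rewrite mulr_ge0 // divr_ge0 // exprn_ge0 // ltW.
Qed.

Lemma twopii_neq0 : twopii R != 0.
Proof.
rewrite /twopii !mulf_neq0 // ?pnatr_eq0 // ?neq0Ci //.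
by rewrite -(rmorph0 (real_complex R)) (inj_eq (@complexI _)) gt_eqF // pi_gt0.
Qed.

Lemma norm_twopii_ge1 : 1 <= `|twopii R|.
Proof.
rewrite /twopii !normrM normCi mulr1 normr_nat normC_real.
rewrite -(rmorph_nat (real_complex R)) -rmorphM -[1]/(1%:C) lecR.
have := pi_ge2 R; rewrite ger0_norm ?pi_ge0 //; lra.
Qed.

Lemma near0_dnbhs (P : R[i] -> Prop) : (\forall z \near (0 : R[i])^', P z) ->
  near0 (fun t => P (t%:C / twopii R)).
Proof.
rewrite near_withinE => /nbhs_ballP[e /= /posC_real[d d0 ->] h].
exists d => // t /andP[t0 td]; apply: h; last first.
  rewrite mulf_neq0 ?invr_neq0 ?twopii_neq0 //.
  by rewrite -(rmorph0 (real_complex R)) (inj_eq (@complexI _)) gt_eqF.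
rewrite -ball_normE /= sub0r normrN normrM normfV normC_real gtr0_norm //.
rewrite ltr_pdivrMr ?(lt_le_trans _ norm_twopii_ge1) //.
apply: (@lt_le_trans _ _ d%:C); first by rewrite ltcR.
by rewrite ler_peMr ?norm_twopii_ge1 // ler0c ltW.
Qed.

Lemma norm_cexp (z : R[i]) : `|cexp z| = (expR (complex.Re z))%:C.
Proof.
rewrite /cexp normrM normC_real (ger0_norm (expR_ge0 _)).
have -> : `|cos (complex.Im z) +i* sin (complex.Im z)| = 1.
  by rewrite normc_def /= cos2Dsin2 sqrtr1.
by rewrite mulr1.
Qed.

Lemma norm_nome (tau : R[i]) :
  `|nome tau| = (expR (- (2 * pi * complex.Im tau)))%:C.
Proof.
rewrite norm_cexp /twopii -complexiE -(rmorph_nat (real_complex R)) -rmorphM.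
by case: tau => x y; simpc.
Qed.

Lemma csin_twopii (t : R) : 0 < t ->
  csin (pi%:C * (t%:C / twopii R)) / (pi%:C * (t%:C / twopii R)) =
  (cexp (t%:C / 2) - cexp (- (t%:C / 2))) / t%:C.
Proof.
move=> t0.
have p0 : pi%:C != 0 :> R[i].
  by rewrite -(rmorph0 (real_complex R)) (inj_eq (@complexI _)) gt_eqF //
    pi_gt0.
have t0' : t%:C != 0 :> R[i].
  by rewrite -(rmorph0 (real_complex R)) (inj_eq (@complexI _)) gt_eqF.
have zE : pi%:C * (t%:C / twopii R) = t%:C / (2 * 'i).
  by rewrite /twopii; move: p0; generalize (pi%:C : R[i]) => p p0; field;
    rewrite p0 neq0Ci.
rewrite zE /csin.
have -> : 'i * (t%:C / (2 * 'i)) = t%:C / 2 :> R[i] by field; rewrite neq0Ci.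
by field; rewrite t0' neq0Ci.
Qed.

Lemma rank_moment_odd k (q : R[i]) : odd k -> rank_moment k q = 0.
Proof.
move=> ok; rewrite /rank_moment.
have -> : (fun n : nat => \sum_(m \in [set: int])
    m%:~R ^+ k * (rank_count m n)%:R * q ^+ n) = (fun=> 0).
  apply/funext => n; rewrite rank_moment_term.
  set S := \sum_(m in _) _; have SN : S = - S.
    rewrite {1}/S (sum_partitions_rankN _ (fun r => r%:~R ^+ k * q ^+ n)).
    rewrite /S -sumrN; apply: eq_bigr => m _.
    by rewrite rmorphN /= exprNn -signr_odd ok expr1 mulN1r mulNr.
  have : S *+ 2 == 0 by rewrite mulr2n {2}SN subrr.
  by rewrite mulrn_eq0 => /eqP.
apply: cvg_lim; first exact: norm_hausdorff.
have -> : series (fun=> 0 : R[i]) = (fun=> 0).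
  by apply/funext => n; rewrite /series /= big1.
exact: cvg_cst.
Qed.

Lemma eq_partition_trace (F : numFieldType) k
    (phi : {ffun 'I_k -> 'I_k.+1} -> rat) (X Y : nat -> F) :
  (forall i, (0 < i <= k)%N -> X i = Y i) ->
  partition_trace phi X = partition_trace phi Y.
Proof.
move=> XY; apply: eq_bigr => m _; congr (_ * _); apply: eq_bigr => i _.
by rewrite XY //= ltn_ord.
Qed.

Lemma moment_identity f (hf : mock_eisenstein f) (tau : R[i]) :
  0 < complex.Im tau ->
  near0 (fun t : R => let q := nome tau in
    cvgn (series (fun k => f k.+1 tau / k.+1`!%:R * t%:C ^+ k.+1)) /\
    t%:C * (cexp (2^-1 * t%:C) * (pochhammer_inf q q * rank_gf (cexp t%:C) q)) =
    (cexp t%:C + -1) *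
      cexp (2 * limn (series (fun k =>
        f k.+1 tau / k.+1`!%:R * t%:C ^+ k.+1)))).
Proof.
move=> tau0; have c0 : pochhammer_inf (nome tau) (nome tau) != 0.
  apply: (@pochhammer_inf_neq0 _ _ (expR (- (2 * pi * complex.Im tau)))).
    by rewrite expR_ge0 expR_lt1 oppr_lt0 !mulr_gt0 // pi_gt0.
  exact: norm_nome.
apply: near0W (near0I (near0_unit R) (near0_dnbhs (hf tau tau0))).
move=> t [/andP[t0 _]] /=; have tn : t%:C != 0 :> R[i] by rewrite gt_eqF.
have -> : twopii R * (t%:C / twopii R) = t%:C by rewrite mulrC divfK
  ?twopii_neq0.
have -> : (fun k => f k.+1 tau * t%:C ^+ k.+1 / k.+1`!%:R) =
    (fun k => f k.+1 tau / k.+1`!%:R * t%:C ^+ k.+1).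
  by apply/funext => k; rewrite mulrAC.
move=> [sc ->]; split=> //.
have tpos : 0 < t by rewrite -ltcR.
have fr (s b c : R[i]) : s / (b * c) = s / b / c by rewrite invfM mulrA.
rewrite (fr _ _ (pochhammer_inf _ _)) (csin_twopii tpos).
have -> : cexp t%:C = cexp (2^-1 * t%:C) * cexp (2^-1 * t%:C) :> R[i].
  by rewrite -cexpD; congr cexp; field.
have E1 : cexp (2^-1 * t%:C) * cexp (- (t%:C / 2)) = 1 :> R[i].
  rewrite -cexpD [t%:C / 2]mulrC subrr -(rmorph0 (real_complex R)) cexp_real
    expR0.
  by [].
(* Here [x] is [e^(t/2)], [y] its inverse, [z] is [t], [c] is [(q)_oo] and [w] the mock Eisenstein
   exponential. *)
have alg (x y z c w : R[i]) : z != 0 -> c != 0 -> x * y = 1 ->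
    z * (x * (c * ((x - y) / z / c * w))) = (x * x + -1) * w.
  by move=> z0 c1 <-; field; rewrite z0 c1.
rewrite [t%:C / 2]mulrC in E1 *; exact: alg tn c0 E1.
Qed.

End Assembly.

Theorem corollary4p2 (R : realType) (f : nat -> R[i] -> R[i])
    (hf : mock_eisenstein f) (k : nat) (hk : (1 <= k)%N)
    (tau : R[i]) (htau : 0 < complex.Im tau) :
  normalized_rank_moment (2 * k) (nome tau) =
    partition_trace (@phiM k)
      (fun j => f (2 * j)%N tau + ratr (bernoulli (2 * j)) / (4 * j)%:R)
  /\
  f (2 * k)%N tau =
    - (ratr (bernoulli (2 * k)) / (4 * k)%:R) +
    partition_trace (@phiS k)
      (fun j => normalized_rank_moment (2 * j) (nome tau)).
Proof.
pose q := nome tau; pose c := pochhammer_inf q q.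
(* Jets of order [N] fix the coefficients below [n.+2]; [moment_series_ode] spends two orders, and
   an equation modulo ['X^n] still determines coefficients up to [n]. *)
pose n := (2 * k)%N; pose N := n.+1.
have h0 : 0 < 2 * pi * complex.Im tau by rewrite !mulr_gt0 // pi_gt0.
pose a : {poly R[i]} := 2%:P *
  \poly_(i < N.+1) (if i is l.+1 then f l.+1 tau / l.+1`!%:R else 0).
pose r : {poly R[i]} := c%:P * \poly_(i < N.+1) (rank_moment i q / i`!%:R).
have id0 := moment_identity hf htau.
have a0 : a`_0 = 0 by rewrite coefCM coef_poly mulr0.
have ja := jetM (jetC N 2)
  (power_series_jet N (near0W (fun t => @proj1 _ _) id0)).
have [u ju [u0 uE]] := jet_cexp a0 ja.
have jX := jetX R N.
have jh := jetM (jetC N 2^-1) jX.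
have jE : jet N (fun t : R => cexp (2^-1 * t%:C))
    (exp_poly _ N \Po (2^-1%:P * 'X)).
  apply: (jet_cexp_axis _ jh); first by rewrite coefCM coefX mulr0.
  by apply: near0W (near0_unit R) => t _; right; simpc.
have jE1 : jet N (fun t : R => cexp t%:C + -1) (exp_poly _ N - 1).
  rewrite -polyCN; apply: jetD (jetC N (-1)).
  rewrite -[exp_poly _ N]comp_polyXr; apply: (jet_cexp_axis _ jX).
    by rewrite coefX.
  by apply: near0W (near0_unit R) => t _; right.
have jR := rank_gf_jet h0 (norm_nome tau) N.
have jl := jetM jX (jetM jE (jetM (jetC N c) jR)).
have jr := jetM jE1 ju.
have /(jet_unique jl) E : jet N _ _ := jet_ext
  (near0W (fun t p => esym (proj2 p)) id0) jr.
have [r0 rE] := moment_series_ode u0 (eqXW (leqnSn n) uE) E.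
have g0 : (a + log_sinh_poly _ N)`_0 = 0 by rewrite coefD a0 coef_poly addr0.
have rodd i : odd i -> r`_i = 0.
  move=> oi; rewrite coefCM coef_poly rank_moment_odd // mul0r.
  by case: ifP; rewrite mulr0.
have rcoef i : (i <= n)%N -> i`!%:R * r`_i = normalized_rank_moment i q.
  move=> ni; rewrite coefCM coef_poly ltnS (leq_trans ni) ?leqnSn //.
  by rewrite mulrC -mulrA divfK ?factf_neq0.
have gcoef j : (0 < j <= k)%N ->
    (2 * j)`!%:R / 2 * (a + log_sinh_poly _ N)`_(2 * j) =
    f (2 * j)%N tau + ratr (bernoulli (2 * j)) / (4 * j)%:R.
  move=> /andP[j0 jk].
  have jN : (2 * j < N)%N by rewrite ltnS leq_mul2l.
  rewrite coefD coefCM !coef_poly (leq_trans jN) ?leqnSn // jN.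
  (* An even positive index avoids the index 1 skipped by [log_sinh_poly]. *)
  have -> : (1 < 2 * j)%N by rewrite (leq_trans _ (leq_mul (leqnn 2) j0)).
  have -> : (4 * j)%:R = 2 * (2 * j)%:R :> R[i] by rewrite -natrM mulnA.
  have y0 : (2 * j)%:R != 0 :> R[i] by rewrite pnatr_eq0 muln_eq0 -lt0n j0.
  have x0 := factf_neq0 R[i] (2 * j).
  have alg (x y v w : R[i]) : x != 0 -> y != 0 ->
      x / 2 * (2 * (v / x) + w / y / x) = v + w / (2 * y).
    by move=> x1 y1; field; rewrite x1 y1.
  have [l lE] : exists l, (2 * j = l.+1)%N by exists (2 * j).-1;
    rewrite prednK // muln_gt0.
  by move: x0 y0; rewrite lE; exact: alg.
have [M S] := traces_of_ode hk r0 g0 rodd rE; split.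
  rewrite -(rcoef (2 * k)%N) // M; apply: eq_partition_trace => j jk;
    exact: gcoef.
have -> : f (2 * k)%N tau =
    (2 * k)`!%:R / 2 * (a + log_sinh_poly _ N)`_(2 * k) -
    ratr (bernoulli (2 * k)) / (4 * k)%:R by rewrite gcoef ?hk ?leqnn // addrK.
rewrite addrC S; congr (_ + _); apply: eq_partition_trace => j /andP[_ jk].
by rewrite rcoef // leq_mul2l.
Qed.
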